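(* Let $G$ be a totally disconnected locally compact group, $\mathbb{K}$ a spherically complete non-Archimedean valued field, and $\mathbb{K}_0$ the closure of its prime field. Then $G$ is normed $\mathbb{K}$-amenable if and only if $G$ is normed $\mathbb{K}_0$-amenable, and $\|G\|_\mathbb{K}=\|G\|_{\mathbb{K}_0}$. More precisely: 1. If $\mathbb{K}_0 \cong \mathbb{F}_p$, then $G$ is normed $\mathbb{K}$-amenable, if and only if $\|G\|_\mathbb{K}=1$, if and only if $G$ is locally elliptic and $p$-free. 2. If $\mathbb{K}_0 \cong \mathbb{Q}$, then $G$ is normed $\mathbb{K}$-amenable, if and only if $\|G\|_\mathbb{K}=1$, if and only if $G$ is locally elliptic. 3. If $\mathbb{K}_0 \cong \mathbb{Q}_p$, then $G$ is normed $\mathbb{K}$-amenable if and only if it is locally elliptic and $p^\mathbb{N}$-free, in which case $\|G\|_\mathbb{K} = \min\{p^k \geq 1 \mid G \text{ is } p^{k+1}\text{-free}\}$.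
   Context: A non-Archimedean valued field is a field $\mathbb{K}$ with an absolute value satisfying the ultrametric inequality; it is spherically complete if every decreasing sequence of balls has nonempty intersection (this implies completeness). $\mathbb{K}_0$ is the closure in $\mathbb{K}$ of the subfield generated by $1$, with the restricted norm; up to equivalence of norms it is $\mathbb{F}_p$ (trivially valued), $\mathbb{Q}$ (trivially valued) or $\mathbb{Q}_p$ ($p$-adic norm); in the last case the norm on $\mathbb{K}$ is normalized so that $|p|_\mathbb{K}=p^{-1}$. For a field $\mathbb{L}$ among $\mathbb{K},\mathbb{K}_0$: $C_b(G,\mathbb{L})$ is the space of continuous bounded functions $G\to\mathbb{L}$ with sup norm and $(g\cdot f)(x)=f(g^{-1}x)$; a normed $\mathbb{L}$-mean is a bounded linear $m:C_b(G,\mathbb{L})\to\mathbb{L}$ with $m(\mathbbm{1}_G)=1$, left-invariant if $m(g\cdot f)=m(f)$; $G$ is normed $\mathbb{L}$-amenable if such an invariant mean exists; $\|G\|_\mathbb{L}$ is the infimum of the operator norms $\|m\|_{op}=\inf\{C\ge0:|m(f)|\le C\|f\|_\infty\}$ of such means ($\infty$ if none). $G$ is locally elliptic if every finite subset lies in a compact subgroup. $G$ is $n$-free if for all open subgroups $V\le U\le G$ with $[U:V]<\infty$, $n\nmid[U:V]$; $p^\mathbb{N}$-free means $p^k$-free for some $k\ge1$. *)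

(* Defs.v *)
From HB Require Import structures.
From mathcomp Require Import all_boot all_order all_algebra.
From mathcomp Require Import all_classical all_reals topology ereal.
Set Implicit Arguments. Unset Strict Implicit. Unset Printing Implicit Defensive.
Import Order.TTheory GRing.Theory Num.Theory.
Local Open Scope classical_set_scope.
Local Open Scope ring_scope.

Record is_topgroup (G : topologicalType) (mul : G -> G -> G) (inv : G -> G)
    (e : G) : Prop := IsTopGroup {
  tg_mulA : forall x y z, mul x (mul y z) = mul (mul x y) z;
  tg_mul1g : forall x, mul e x = x;
  tg_mulg1 : forall x, mul x e = x;
  tg_mulVg : forall x, mul (inv x) x = e;
  tg_mulgV : forall x, mul x (inv x) = e;
  tg_mul_cont : continuous (fun xy : G * G => mul xy.1 xy.2);
  tg_inv_cont : continuous inv }.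

Definition is_subgroup (G : Type) (mul : G -> G -> G) (inv : G -> G) (e : G)
    (H : set G) : Prop :=
  H e /\ (forall x y, H x -> H y -> H (mul x y)) /\ (forall x, H x -> H (inv x)).

Definition locally_elliptic (G : topologicalType) (mul : G -> G -> G)
    (inv : G -> G) (e : G) : Prop :=
  forall s : seq G, exists H : set G,
    is_subgroup mul inv e H /\ compact H /\ (forall x, x \in s -> H x).

Definition index_is (G : choiceType) (mul : G -> G -> G) (inv : G -> G)
    (U V : set G) (n : nat) : Prop :=
  exists s : seq G, [/\ size s = n, uniq s, (forall x, x \in s -> U x),
    (forall u, U u -> exists2 x, x \in s & V (mul (inv x) u)) &
    (forall x y, x \in s -> y \in s -> V (mul (inv x) y) -> x = y)].

Definition open_subgroup (G : topologicalType) (mul : G -> G -> G)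
    (inv : G -> G) (e : G) (H : set G) : Prop :=
  is_subgroup mul inv e H /\ open H.

Definition n_free (G : topologicalType) (mul : G -> G -> G) (inv : G -> G)
    (e : G) (n : nat) : Prop :=
  forall U V : set G, open_subgroup mul inv e U -> open_subgroup mul inv e V ->
    V `<=` U -> forall k : nat, index_is mul inv U V k -> ~ (n %| k)%N.

Definition pN_free (G : topologicalType) (mul : G -> G -> G) (inv : G -> G)
    (e : G) (p : nat) : Prop :=
  exists k : nat, (1 <= k)%N /\ n_free mul inv e (p ^ k).

Record is_nonarch_abs (R : realType) (K : fieldType) (abs : K -> R) : Prop :=
  IsNonarchAbs {
  abs_ge0 : forall x, 0 <= abs x;
  abs_eq0 : forall x, abs x = 0 <-> x = 0;
  abs_mul : forall x y, abs (x * y) = abs x * abs y;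
  abs_ultra : forall x y, abs (x + y) <= Num.max (abs x) (abs y) }.

Definition cball (R : realType) (K : fieldType) (abs : K -> R) (a : K) (r : R)
  : set K := [set y | abs (y - a) <= r].

Definition spherically_complete (R : realType) (K : fieldType) (abs : K -> R)
  : Prop :=
  forall (a : nat -> K) (r : nat -> R), (forall n, 0 < r n) ->
    (forall n, cball abs (a n.+1) (r n.+1) `<=` cball abs (a n) (r n)) ->
    exists x, forall n, cball abs (a n) (r n) x.

Definition prime_subfield (K : fieldType) : set K :=
  [set x | exists a b : int, (b%:~R : K) != 0 /\ x = a%:~R / b%:~R].

Definition K0set (R : realType) (K : fieldType) (abs : K -> R) : set K :=
  [set x | forall eps : R, 0 < eps ->
     exists2 y, @prime_subfield K y & abs (x - y) < eps].

(* L : set K is the subfield (K itself = setT, or K0) *)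
Definition Cb (G : topologicalType) (R : realType) (K : fieldType)
    (abs : K -> R) (L : set K) : set (G -> K) :=
  [set f | (forall x, L (f x)) /\ (exists M : R, forall x, abs (f x) <= M) /\
     (forall x (eps : R), 0 < eps -> exists U : set G,
        [/\ open U, U x & forall y, U y -> abs (f y - f x) < eps])].

Definition supnorm (G : Type) (R : realType) (K : Type) (abs : K -> R)
    (f : G -> K) : R := sup [set abs (f x) | x in [set: G]].

Definition normed_mean (G : topologicalType) (R : realType) (K : fieldType)
    (abs : K -> R) (L : set K) (m : (G -> K) -> K) : Prop :=
  [/\ (forall f, Cb abs L f -> L (m f)),
      (forall f g, Cb abs L f -> Cb abs L g -> m (f \+ g) = m f + m g),
      (forall (c : K) f, L c -> Cb abs L f -> m (fun x => c * f x) = c * m f),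
      (exists C : R, forall f, Cb abs L f -> abs (m f) <= C * supnorm abs f) &
      m (fun _ => 1) = 1].

Definition left_invariant (G : topologicalType) (R : realType) (K : fieldType)
    (abs : K -> R) (L : set K) (mul : G -> G -> G) (inv : G -> G)
    (m : (G -> K) -> K) : Prop :=
  forall g f, Cb abs L f -> m (fun x => f (mul (inv g) x)) = m f.

Definition invariant_mean (G : topologicalType) (R : realType) (K : fieldType)
    (abs : K -> R) (L : set K) (mul : G -> G -> G) (inv : G -> G)
    (m : (G -> K) -> K) : Prop :=
  normed_mean abs L m /\ left_invariant abs L mul inv m.

Definition normed_amenable (G : topologicalType) (R : realType) (K : fieldType)
    (abs : K -> R) (L : set K) (mul : G -> G -> G) (inv : G -> G) : Prop :=
  exists m, invariant_mean abs L mul inv m.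

Definition opnorm (G : topologicalType) (R : realType) (K : fieldType)
    (abs : K -> R) (L : set K) (m : (G -> K) -> K) : \bar R :=
  ereal_inf [set C%:E | C in [set C : R | 0 <= C /\
     forall f, Cb abs L f -> abs (m f) <= C * supnorm abs f]].

(* ||G||_L : infimum of the norms of invariant means (+oo if none) *)
Definition group_norm (G : topologicalType) (R : realType) (K : fieldType)
    (abs : K -> R) (L : set K) (mul : G -> G -> G) (inv : G -> G) : \bar R :=
  ereal_inf [set opnorm abs L m | m in invariant_mean abs L mul inv].

(* Main.v *)
(** A mean m over a spherically complete subfield L yields a purely combinatorial
    condition that no longer mentions L beyond the values |k| of integers, and
    conversely, so that K and its prime field closure give the same infimum.

    If V <= U are open subgroups with [U : V] = k, the group G is partitioned by
    k translates of one open set, so k m(A) = 1 and 1 <= ||m|| |k|.  If some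
    finite set S had only infinite orbits on G/U, with U compact open, a flow on
    the Schreier graph of S pushing unit mass from every vertex to infinity,
    with integral hence bounded values, would express 1 as a sum of
    coboundaries f - s f, against m(1) = 1; a finite orbit is a compact open
    set whose stabiliser is a compact open subgroup containing S.

    Conversely, let G be locally elliptic with 1 <= M |k| for all indices k.
    Averaging over a finite quotient of a compact open subgroup containing the
    g_i gives |c| <= M ||c + sum (g_i f_i - f_i)||, and Ingleton's ultrametric
    Hahn-Banach theorem extends c + sum (g_i f_i - f_i) |-> c to a mean of norm
    at most M. *)
Require Import Defs.
From HB Require Import structures.
From mathcomp Require Import all_boot all_order all_algebra.
From mathcomp Require Import all_classical all_reals topology ereal.
From mathcomp Require Import ring.
Import Order.TTheory GRing.Theory Num.Theory.
Local Open Scope classical_set_scope.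
Local Open Scope ring_scope.

(** * Compact open subgroups *)

(** If every member of [F] met [Z], the traces on [Z] would generate a proper filter; its cluster
    point in [Z] would lie in every closed member of [F]. *)
Lemma compact_disjoint_family (T : topologicalType) (F : set (set T))
    (Z : set T) :
  F !=set0 -> (forall A B, F A -> F B -> F (A `&` B)) ->
  (forall A, F A -> closed A) -> compact Z ->
  (forall z, Z z -> exists2 A, F A & ~ A z) ->
  exists2 A, F A & A `&` Z = set0.
Proof.
move=> [A0 FA0] FI Fcl cZ ZF; apply: contrapT => nA.
have ne A : F A -> A `&` Z !=set0.
  by move=> FA; apply/set0P/negP => /eqP A0Z; apply: nA; exists A.
pose S := filter_from F (fun A => A `&` Z).
have PF : ProperFilter S.
  apply: filter_from_proper => //; apply: filter_from_filter; first by exists A0.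
  move=> A B FA FB; exists (A `&` B); first exact: FI.
  by move=> x [[Ax Bx] Zx]; split.
have SZ : S Z by exists A0 => // x [].
have [z [Zz clz]] := cZ S PF SZ.
have [A FA] := ZF z Zz; apply; apply: (Fcl A FA) => B nB.
have SA : S A by exists A => // x [].
by have [y [Ay By]] := clz A B SA nB; exists y.
Qed.

Section TopGroup.
Context (G : topologicalType) (mul : G -> G -> G) (inv : G -> G) (e : G).
Context (HG : is_topgroup mul inv e).
Local Infix "**" := mul (at level 40, left associativity).
Local Notation subgrp := (is_subgroup mul inv e).
Local Notation osubgrp := (open_subgroup mul inv e).

Lemma tgmulgA x y z : x ** (y ** z) = x ** y ** z. Proof. exact: tg_mulA HG _ _ _. Qed.
Lemma tgmul1g x : e ** x = x. Proof. exact: tg_mul1g HG _. Qed.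
Lemma tgmulg1 x : x ** e = x. Proof. exact: tg_mulg1 HG _. Qed.
Lemma tgmulVg x : inv x ** x = e. Proof. exact: tg_mulVg HG _. Qed.
Lemma tgmulgV x : x ** inv x = e. Proof. exact: tg_mulgV HG _. Qed.
Lemma tgmulKg x y : inv x ** (x ** y) = y. Proof. by rewrite tgmulgA tgmulVg tgmul1g. Qed.
Lemma tgmulKVg x y : x ** (inv x ** y) = y. Proof. by rewrite tgmulgA tgmulgV tgmul1g. Qed.
Lemma tgmulgK x y : y ** x ** inv x = y. Proof. by rewrite -tgmulgA tgmulgV tgmulg1. Qed.
Lemma tgmulgKV x y : y ** inv x ** x = y. Proof. by rewrite -tgmulgA tgmulVg tgmulg1. Qed.
Lemma tgmulgI x y z : x ** y = x ** z -> y = z.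
Proof. by move=> h; rewrite -(tgmulKg x y) h tgmulKg. Qed.
Lemma tginvg_uniq x y : x ** y = e -> inv x = y.
Proof. by move=> h; apply: (tgmulgI x); rewrite tgmulgV h. Qed.
Lemma tginvgK x : inv (inv x) = x. Proof. by apply: tginvg_uniq; rewrite tgmulVg. Qed.
Lemma tginvMg x y : inv (x ** y) = inv y ** inv x.
Proof. by apply: tginvg_uniq; rewrite tgmulgA tgmulgK tgmulgV. Qed.
Lemma tginvg1 : inv e = e. Proof. by apply: tginvg_uniq; rewrite tgmul1g. Qed.

Lemma near_mul (x y : G) (A : set G) : nbhs (x ** y) A ->
  \forall x' \near x & y' \near y, A (x' ** y').
Proof. by move=> nA; have := @tg_mul_cont _ _ _ _ HG (x, y) A nA. Qed.

Lemma near_inv (x : G) (A : set G) : nbhs (inv x) A ->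
  \forall x' \near x, A (inv x').
Proof. exact: (@tg_inv_cont _ _ _ _ HG x). Qed.

Lemma near_mull (g x : G) (A : set G) : nbhs (g ** x) A ->
  \forall x' \near x, A (g ** x').
Proof.
move=> /near_mul [[B C] /= [nB nC] BC]; apply: filterS nC => x' Cx'.
by apply: (BC (g, x')); split => //=; apply: nbhs_singleton.
Qed.

Lemma near_mulr (g x : G) (A : set G) : nbhs (x ** g) A ->
  \forall x' \near x, A (x' ** g).
Proof.
move=> /near_mul [[B C] /= [nB nC] BC]; apply: filterS nB => x' Cx'.
by apply: (BC (x', g)); split => //=; apply: nbhs_singleton.
Qed.

Lemma open_mull (g : G) (A : set G) : open A -> open [set x | A (g ** x)].
Proof.
rewrite !openE => oA x Ax; rewrite /interior; apply: near_mull; exact: oA.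
Qed.

Lemma open_mulr (g : G) (A : set G) : open A -> open [set x | A (x ** g)].
Proof.
rewrite !openE => oA x Ax; rewrite /interior; apply: near_mulr; exact: oA.
Qed.

Lemma compact_mulr (g : G) (A : set G) :
  compact A -> compact [set x | A (x ** g)].
Proof.
move=> cA; have -> : [set x | A (x ** g)] = (fun x => x ** inv g) @` A.
  apply/seteqP; split=> [x Ax|_ [x Ax <-]] /=; last by rewrite tgmulgKV.
  by exists (x ** g) => //; rewrite tgmulgK.
apply: continuous_compact => //; apply: continuous_subspaceT => x B nB.
exact: near_mulr.
Qed.

Lemma compact_mull (g : G) (A : set G) :
  compact A -> compact [set x | A (g ** x)].
Proof.
move=> cA; have -> : [set x | A (g ** x)] = (fun x => inv g ** x) @` A.
  apply/seteqP; split=> [x Ax|_ [x Ax <-]] /=; last by rewrite tgmulKVg.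
  by exists (g ** x) => //; rewrite tgmulKg.
apply: continuous_compact => //; apply: continuous_subspaceT => x B nB.
exact: near_mull.
Qed.

Lemma subgrpVM V x y : subgrp V -> V (inv x ** y) -> V (inv y ** x).
Proof. by move=> [_ [_ Vi]] /Vi; rewrite tginvMg tginvgK. Qed.

Lemma subgrpT V x y z : subgrp V -> V (inv x ** y) -> V (inv y ** z) ->
  V (inv x ** z).
Proof.
move=> [_ [VM _]] h1 h2.
have -> : inv x ** z = inv x ** y ** (inv y ** z) by rewrite tgmulgA tgmulgK.
exact: VM.
Qed.

Lemma subgrp_openP H : subgrp H -> nbhs e H -> open H.
Proof.
move=> [_ [HM _]] nH; rewrite openE => x Hx; rewrite /interior.
have : nbhs (inv x ** x) H by rewrite tgmulVg.
by move=> /near_mull; apply: filterS => y Hy; rewrite -(tgmulKVg x y); apply: HM.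
Qed.

Lemma osubgrp_nbhs H : osubgrp H -> nbhs e H.
Proof. by move=> [[He _] oH]; apply: open_nbhs_nbhs. Qed.

Lemma near_coset V x : osubgrp V -> \forall y \near x, V (inv x ** y).
Proof. by move=> oV; apply: near_mull; rewrite tgmulVg; apply: osubgrp_nbhs. Qed.

Lemma osubgrp_closed H : osubgrp H -> closed H.
Proof.
move=> oH x clx; have [y [Hy Vy]] := clx _ (near_coset H x oH).
have [[_ [HM Hi]] _] := oH.
by rewrite -(tgmulKVg y x); apply: HM => //; rewrite -(tginvgK x) -tginvMg; apply: Hi.
Qed.

Lemma osubgrpT : osubgrp setT.
Proof. by split; [|exact: openT]. Qed.

(** The condition is [g W = W], written as two inclusions so that closure under inverses is
    immediate. *)
Definition stab (W : set G) : set G :=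
  [set g | forall w, W w -> W (g ** w) /\ W (inv g ** w)].

Lemma stab_subgrp W : subgrp (stab W).
Proof.
split; first by move=> w Ww; rewrite tginvg1 tgmul1g.
split=> [x y sx sy w Ww|x sx w Ww].
  rewrite tginvMg -!tgmulgA; split; first by apply: (sx _ _).1; apply: (sy _ _).1.
  by apply: (sy _ _).2; apply: (sx _ _).2.
by rewrite tginvgK; split; [apply: (sx _ _).2|apply: (sx _ _).1].
Qed.

Lemma stab_sub W : W e -> stab W `<=` W.
Proof. by move=> We g /(_ e We) []; rewrite tgmulg1. Qed.

(** A tube argument: multiplication is continuous at every [(e, w)] and [W] is compact, so one
    neighbourhood of [e] moves all of [W] into the open set [W]. *)
Lemma stab_open W : compact W -> open W -> open (stab W).
Proof.
move=> cW oW; apply: subgrp_openP; first exact: stab_subgrp.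
have mulW : \forall g \near e, W `<=` (fun w => W (g ** w)).
  apply: (iffLR (compact_near_coveringP W) cW) => w Ww.
  have : nbhs (e ** w) W by rewrite tgmul1g; apply: open_nbhs_nbhs.
  move=> /near_mul [[A B] /= [nA nB] AB]; exists (B, A) => // -[x g] /= [Bx Ag].
  exact: (AB (g, x)).
have invW : \forall g \near e, W `<=` (fun w => W (inv g ** w)).
  by apply: (near_inv e [set g | W `<=` (fun w => W (g ** w))]); rewrite tginvg1.
apply: filterS (filterI mulW invW) => g [h1 h2] w Ww.
by split; [exact: h1|exact: h2].
Qed.

Lemma stab_osubgrp W : compact W -> open W -> osubgrp (stab W).
Proof. by move=> cW oW; split; [exact: stab_subgrp|exact: stab_open]. Qed.

Lemma stab_compact W : W e -> compact W -> open W -> compact (stab W).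
Proof.
move=> We cW oW; have cl := osubgrp_closed _ (stab_osubgrp W cW oW).
exact: (subclosed_compact cl cW (stab_sub W We)).
Qed.

Lemma finite_transversal_cover H V : compact H -> osubgrp V ->
  exists2 s : seq G, (forall x, x \in s -> H x) &
    forall h, H h -> exists2 x, x \in s & V (inv x ** h).
Proof.
move=> cH oV; pose D := [set s : seq G | forall x, x \in s -> H x].
pose up (s : seq G) := [set t | D t /\ {subset s <= t}].
(* The filter of all sufficiently large finite sequences in [H] turns the near-covering form of
   compactness into the extraction of a finite subcover. *)
have FF : Filter (filter_from D up).
  apply: filter_from_filter; first by exists [::].
  move=> s t Ds Dt; exists (s ++ t); first by move=> x; rewrite mem_cat => /orP[/Ds|/Dt].
  move=> w [Dw sub]; split; split => // x xs; apply: sub; rewrite mem_cat xs ?orbT//.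
pose P (s : seq G) (h : G) := exists2 x, x \in s & V (inv x ** h).
have [|s Ds Ps] := iffLR (compact_near_coveringP H) cH _ (filter_from D up) P FF.
  move=> x Hx; exists ([set y | V (inv x ** y)], up [:: x]).
    split => /=; first exact: near_coset.
    by exists [:: x] => // z; rewrite inE => /eqP ->.
  move=> [y t] /= [Vy [Dt sub]]; exists x => //; apply: sub; exact: mem_head.
by exists s => // h Hh; apply: (Ps s) => //; split.
Qed.

(** The product [H U] is a finite union of cosets of [U] because [H] is compact; it is therefore
    compact and open, and its stabiliser contains [H]. *)
Lemma compact_subgroup_osubgrp H U : subgrp H -> compact H ->
  osubgrp U -> compact U ->
  exists W, [/\ osubgrp W, compact W & H `<=` W].
Proof.
move=> sH cH oU cU; have [s sH' cov] := finite_transversal_cover H U cH oU.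
have [[Ue [UM Ui]] opU] := oU.
pose W := \bigcup_(x in [set` s]) [set y | U (inv x ** y)].
have WE y : W y <-> exists2 h, H h & U (inv h ** y).
  split=> [[x /= xs Uxy]|[h Hh Uh]]; first by exists x => //; apply: sH'.
  have [x xs Vx] := cov h Hh; exists x => //=.
  exact: (subgrpT _ x h y oU.1).
have cW : compact W.
  rewrite /W bigcup_seq; apply: bigsetU_compact => x _; exact: compact_mull.
have opW : open W by apply: bigcup_open => x _; exact: open_mull.
have We : W e by apply/WE; exists e; [exact: sH.1|rewrite tgmulg1; apply: Ui].
exists (stab W); split; [exact: stab_osubgrp|exact: stab_compact|].
move=> h Hh w /WE [k Hk Uk]; have [_ [HM Hi]] := sH.
split; apply/WE.
  by exists (h ** k); [apply: HM|rewrite tginvMg -tgmulgA tgmulKg].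
exists (inv h ** k); [by apply: HM => //; apply: Hi|].
by rewrite tginvMg -tgmulgA tgmulKg.
Qed.

Lemma finite_index H V : subgrp H -> compact H -> osubgrp V ->
  exists k, index_is mul inv H V k.
Proof.
move=> sH cH oV; have [t tH cov] := finite_transversal_cover H V cH oV.
(* Thinning the finite cover, by induction on [t], keeps one representative per coset of [V]. *)
suff [s [us st sep cov']] : exists s : seq G, [/\ uniq s, {subset s <= t},
    (forall x y, x \in s -> y \in s -> V (inv x ** y) -> x = y) &
    forall y, y \in t -> exists2 x, x \in s & V (inv x ** y)].
  exists (size s), s; split => //; first by move=> x /st; apply: tH.
  move=> u /cov [y yt Vy]; have [x xs Vx] := cov' y yt; exists x => //.
  exact: (subgrpT _ x y u oV.1).
elim: t {tH cov} => [|a t [s [us st sep cov]]]; first by exists [::].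
have [[x xs Vx]|na] := pselect (exists2 x, x \in s & V (inv x ** a)).
  exists s; split => //; first by move=> y /st yt; rewrite inE yt orbT.
  by move=> y; rewrite inE => /orP[/eqP->|/cov//]; exists x.
exists (a :: s); split.
- rewrite /= us andbT; apply/negP => ais; apply: na; exists a => //.
  by rewrite tgmulVg; case: oV.1.
- by move=> y; rewrite !inE => /orP[->//|/st->]; rewrite orbT.
- move=> x y; rewrite !inE => /orP[/eqP->|xs] /orP[/eqP->|ys] // Vxy.
  + by case: na; exists y => //; apply: subgrpVM Vxy; exact: oV.1.
  + by case: na; exists x.
  + exact: sep.
- move=> y; rewrite inE => /orP[/eqP->|/cov [x xs Vx]]; [exists a|exists x] => //.
  + exact: mem_head.
  + by rewrite tgmulVg; case: oV.1.
  + by rewrite inE xs orbT.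
Qed.

(** Compactness of [A] gives a neighbourhood [N] of [e] such that [A N N^-1] misses [B]; then [A N]
    and [B N] are the two open sets. *)
Lemma separate_compact_closed A B : compact A -> closed B -> A `&` B = set0 ->
  exists U V : set G, [/\ open U, open V, A `<=` U, B `<=` V & U `&` V = set0].
Proof.
move=> cA cB AB0.
have nAB : \forall g \near e, A `<=` (fun a => (~` B) (a ** g)).
  apply: (iffLR (compact_near_coveringP A) cA) => a Aa.
  have : nbhs (a ** e) (~` B).
    rewrite tgmulg1; apply: open_nbhs_nbhs; split; first exact: closed_openC.
    by move=> Ba; have : (A `&` B) a by []; rewrite AB0.
  by move=> /near_mul.
have [N [oN Ne] HN] : exists2 N, open_nbhs e N &
    forall v w, N v -> N w -> forall a, A a -> ~ B (a ** (v ** inv w)).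
  have : nbhs (e ** e) [set g | A `<=` (fun a => (~` B) (a ** g))].
    by rewrite tgmulg1.
  move=> /near_mul [[M1 M2] /= [n1 n2] M12].
  have nM : nbhs e (M1 `&` [set w | M2 (inv w)]).
    by apply: filterI => //; apply: (near_inv e); rewrite tginvg1.
  move: nM; rewrite nbhsE => -[N oN NM]; exists N => // v w Nv Nw a Aa.
  by apply: (M12 (v, inv w)) => //=; split; [case: (NM v Nv)|case: (NM w Nw)].
exists (\bigcup_(a in A) [set x | N (inv a ** x)]).
exists (\bigcup_(b in B) [set x | N (inv b ** x)]); split.
- by apply: bigcup_open => a _; exact: open_mull.
- by apply: bigcup_open => a _; exact: open_mull.
- by move=> a Aa; exists a => //=; rewrite tgmulVg.
- by move=> a Aa; exists a => //=; rewrite tgmulVg.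
- rewrite -subset0 => x [[a Aa Na] [b Bb Nb]]; apply: (HN _ _ Na Nb a Aa).
  by rewrite tginvMg tginvgK tgmulgA tgmulKVg tgmulKVg.
Qed.

(** * Van Dantzig's theorem *)

Section VanDantzig.
Context (Htd : totally_disconnected [set: G]) (Hlc : locally_compact [set: G]).

(* In a compact Hausdorff space quasi-components are connected; applied to a
   compact neighbourhood of the identity. *)
Lemma compact_open_nbhs (A : set G) : nbhs e A ->
  exists W : set G, [/\ W e, compact W, open W & W `<=` A].
Proof.
move=> nA; have [C nC' [cC clC]] := Hlc e I.
have nC : nbhs e C.
  by move: nC'; rewrite /within /=; apply: filterS => x; apply.
(* [F] consists of the relatively clopen subsets of [C] containing [e]; their intersection [Q] is
   the quasi-component of [e] in [C]. *)
pose F := [set D : set G | [/\ closed D, D `<=` C, D e & closed (C `\` D)]].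
have Ce : C e by apply: nbhs_singleton.
have FC : F C by split => //; rewrite setDv; exact: closed0.
have FI D E : F D -> F E -> F (D `&` E).
  move=> [cD DC De cD'] [cE EC Ee cE']; split.
  - exact: closedI.
  - by move=> x [/DC].
  - by [].
  - by rewrite setDIr; exact: closedU.
have F0 : F !=set0 by exists C.
have Fcl D : F D -> closed D by case.
have disj Z : closed Z -> Z `<=` C -> (forall z, Z z -> exists2 D, F D & ~ D z) ->
    exists2 D, F D & D `&` Z = set0.
  by move=> cZ ZC; apply: compact_disjoint_family => //; apply: (subclosed_compact _ cC).
pose Q := \bigcap_(D in F) D.
have Qcl : closed Q by apply: closed_bigI.
have QC : Q `<=` C by move=> x; apply.
have Qe : Q e by move=> D [].
(* Separate [A1] and [B1] by open sets [U] and [V]. Compactness puts some [D] of [F] inside their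
   union; then [D \ V] is again in [F], so [Q] avoids [V] and with it [B1]. *)
have Qhalf A1 B1 : closed A1 -> closed B1 -> A1 `&` B1 = set0 -> Q `<=` A1 `|` B1 ->
    A1 `<=` C -> A1 e -> Q `<=` A1.
  move=> cA1 cB1 AB0 QAB A1C A1e.
  have [U [V [oU oV AU BV UV0]]] := separate_compact_closed A1 B1
    (subclosed_compact cA1 cC A1C) cB1 AB0.
  have [|//|z [Cz nz]|D FD D0] := disj (C `&` ~` (U `|` V)).
  - by apply: closedI => //; apply: open_closedC; exact: openU.
  - apply: contrapT => nD; apply: nz.
    have [/AU|/BV] : (A1 `|` B1) z; [|by left|by right].
    by apply: QAB => D FD; apply: contrapT => nDz; apply: nD; exists D.
  have DUV x : D x -> U x \/ V x.
    move=> Dx; apply: contrapT => nUV.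
    suff : (D `&` (C `&` ~` (U `|` V))) x by rewrite D0.
    by split => //; split => //; case: FD => _ DC _ _; apply: DC.
  have [cD DC De cD'] := FD.
  have UV x : U x -> V x -> False by move=> Ux Vx; have : (U `&` V) x by []; rewrite UV0.
  have F' : F (D `&` ~` V).
    split.
    - by apply: closedI => //; exact: open_closedC.
    - by move=> x [/DC].
    - by split => // Ve; apply: (UV e) => //; apply: AU.
    - have -> : C `\` (D `&` ~` V) = (C `\` D) `|` (D `&` ~` U).
        apply/seteqP; split=> x.
          move=> [Cx nDV]; have [Dx|] := pselect (D x); [right|by left].
          by split => // Ux; apply: nDV; split => // Vx; apply: (UV x).
        move=> [[Cx nD]|[Dx nU]]; first by split => // -[].
        split; first exact: DC.
        by move=> [_ nV]; case: (DUV x Dx).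
      by apply: closedU => //; apply: closedI => //; exact: open_closedC.
  move=> x Qx; have [_ nVx] := Qx _ F'.
  by have [//|Bx] := QAB x Qx; case: nVx; apply: BV.
have Qconn : connected Q.
  move=> B [b Bb] [O oO BO] [E cE BE].
  have cB : closed B by rewrite BE; exact: closedI.
  have QB : Q `\` B = Q `&` ~` O.
    rewrite BO; apply/seteqP; split=> x [Qx h]; split => //.
      by move=> Ox; apply: h.
    by move=> [_ /h].
  have cQB : closed (Q `\` B).
    by rewrite QB; apply: closedI => //; exact: open_closedC.
  have BQ : B `<=` Q by rewrite BO => x [].
  apply/seteqP; split => //; have [Be|nBe] := pselect (B e).
    apply: (Qhalf B (Q `\` B)) => //.
    - by apply/seteqP; split=> x // [? []].
    - by move=> x Qx; have [|] := pselect (B x); [left|right].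
    - by move=> x /BQ /QC.
  have : Q `<=` Q `\` B.
    apply: (Qhalf (Q `\` B) B) => //.
    - by apply/seteqP; split=> x // [[]].
    - by move=> x Qx; have [|] := pselect (B x); [right|left].
    - by move=> x [/QC].
  by move=> h; case: (h b (BQ b Bb)).
have Q1 x : Q x -> x = e.
  move=> Qx; have : connected_component setT e x by exists Q.
  by rewrite Htd.
(* Since [Q] is reduced to [e], a second use of compactness gives a member [D] of [F] inside the
   open set [O]. Removing the closed set [C \ D] from [O] leaves [D], which is thus open in [G]. *)
pose O := (C `&` A)°; have oO : open O by exact: open_interior.
have OC : O `<=` C `&` A by exact: interior_subset.
have [|//|z [Cz nz]|D FD D0] := disj (C `&` ~` O).
- by apply: closedI => //; exact: open_closedC.
- apply: contrapT => nD; apply: nz.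
  have -> : z = e by apply: Q1 => D FD; apply: contrapT => nDz; apply: nD; exists D.
  by rewrite /O /interior /=; apply: filterI.
have [cD DC De cD'] := FD.
have DO : D `<=` O.
  move=> x Dx; apply: contrapT => nO; suff : (D `&` (C `&` ~` O)) x by rewrite D0.
  by split => //; split => //; apply: DC.
exists D; split => //; last by move=> x /DO /OC [].
  exact: (subclosed_compact cD cC DC).
have -> : D = O `&` ~` (C `\` D).
  apply/seteqP; split=> x.
    by move=> Dx; split; [exact: DO|move=> []].
  by move=> [/OC [Cx _] h]; apply: contrapT => nD; apply: h.
by apply: openI => //; exact: closed_openC.
Qed.

Lemma van_dantzig (A : set G) : nbhs e A ->
  exists W, [/\ osubgrp W, compact W & W `<=` A].
Proof.
move=> /compact_open_nbhs [W [We cW oW WA]]; exists (stab W); split.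
- exact: stab_osubgrp.
- exact: stab_compact.
- exact: subset_trans (stab_sub W We) WA.
Qed.

Lemma locally_elliptic_compact_open (s : seq G) : locally_elliptic mul inv e ->
  exists W, [/\ osubgrp W, compact W & forall x, x \in s -> W x].
Proof.
move=> /(_ s) [H [sH [cH Hs]]].
have [U [oU cU _]] := van_dantzig setT filterT.
have [W [oW cW HW]] := compact_subgroup_osubgrp H U sH cH oU cU.
by exists W; split => // x /Hs /HW.
Qed.

End VanDantzig.
End TopGroup.

Arguments compact_mull {G mul inv e} _.
Arguments compact_mulr {G mul inv e} _.
Arguments finite_index {G mul inv e} _.
Arguments locally_elliptic_compact_open {G mul inv e} _.
Arguments near_mul {G mul inv e} _.
Arguments open_mull {G mul inv e} _.
Arguments open_mulr {G mul inv e} _.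
Arguments stab_compact {G mul inv e} _.
Arguments stab_subgrp {G mul inv e} _.
Arguments subgrpT {G mul inv e} _.
Arguments subgrpVM {G mul inv e} _.
Arguments tginvMg {G mul inv e} _.
Arguments tginvgK {G mul inv e} _.
Arguments tgmul1g {G mul inv e} _.
Arguments tgmulKVg {G mul inv e} _.
Arguments tgmulKg {G mul inv e} _.
Arguments tgmulVg {G mul inv e} _.
Arguments tgmulg1 {G mul inv e} _.
Arguments tgmulgA {G mul inv e} _.
Arguments tgmulgKV {G mul inv e} _.
Arguments tgmulgV {G mul inv e} _.
Arguments van_dantzig {G mul inv e} _.

(** * Ingleton's theorem *)

Section NonarchAbs.
Context (R : realType) (K : fieldType) (abs : K -> R).
Context (Habs : is_nonarch_abs abs).

Lemma nabs_ge0 x : 0 <= abs x. Proof. exact: (abs_ge0 Habs). Qed.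
Lemma nabs0 : abs 0 = 0. Proof. exact/(abs_eq0 Habs). Qed.
Lemma nabs_eq0 x : (abs x == 0) = (x == 0).
Proof. by apply/eqP/eqP => /(abs_eq0 Habs). Qed.
Lemma nabs_gt0 x : (0 < abs x) = (x != 0).
Proof. by rewrite lt_def nabs_ge0 andbT nabs_eq0. Qed.
Lemma nabsM x y : abs (x * y) = abs x * abs y. Proof. exact: (abs_mul Habs). Qed.
Lemma nabs1 : abs 1 = 1.
Proof.
have n0 : abs 1 != 0 by rewrite nabs_eq0 oner_eq0.
by apply: (mulfI n0); rewrite -nabsM !mulr1.
Qed.
Lemma nabsX x n : abs (x ^+ n) = abs x ^+ n.
Proof. by elim: n => [|n IH]; rewrite ?expr0 ?nabs1// !exprS nabsM IH. Qed.
Lemma nabsN x : abs (- x) = abs x.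
Proof.
rewrite -mulN1r nabsM -[RHS]mul1r; congr (_ * _).
have : abs (-1) ^+ 2 = 1 by rewrite -nabsX sqrrN expr1n nabs1.
by move=> /eqP; rewrite sqrp_eq1 ?nabs_ge0// => /eqP.
Qed.
Lemma nabsV x : abs x^-1 = (abs x)^-1.
Proof.
have [->|x0] := eqVneq x 0; first by rewrite invr0 nabs0 invr0.
have a0 : abs x != 0 by rewrite nabs_eq0.
by apply: (mulfI a0); rewrite -nabsM !mulfV ?nabs1.
Qed.
Lemma nabsB x y : abs (x - y) = abs (y - x).
Proof. by rewrite -nabsN opprB. Qed.
Lemma nabsD_le x y r : abs x <= r -> abs y <= r -> abs (x + y) <= r.
Proof.
by move=> xr yr; apply: (le_trans (abs_ultra Habs _ _)); rewrite ge_max xr.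
Qed.
Lemma nabsB_le x y z r : abs (x - y) <= r -> abs (y - z) <= r -> abs (x - z) <= r.
Proof. by move=> h1 h2; rewrite -(subrKA y) nabsD_le. Qed.
Lemma nabs_sum_le (I : eqType) (s : seq I) (F : I -> K) r : 0 <= r ->
  (forall i, i \in s -> abs (F i) <= r) -> abs (\sum_(i <- s) F i) <= r.
Proof.
move=> r0 h; rewrite big_seq; elim/big_ind: _ => //; first by rewrite nabs0.
by move=> x y; exact: nabsD_le.
Qed.
Lemma nabs_nat n : abs n%:R <= 1.
Proof.
elim: n => [|n IH]; first by rewrite nabs0.
by rewrite -natr1 nabsD_le ?nabs1.
Qed.

End NonarchAbs.

Arguments nabs0 {R K abs} _.
Arguments nabs1 {R K abs} _.
Arguments nabsB {R K abs} _.
Arguments nabsB_le {R K abs} _.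
Arguments nabsD_le {R K abs} _.
Arguments nabsM {R K abs} _.
Arguments nabsN {R K abs} _.
Arguments nabsV {R K abs} _.
Arguments nabs_eq0 {R K abs} _.
Arguments nabs_ge0 {R K abs} _.
Arguments nabs_gt0 {R K abs} _.
Arguments nabs_nat {R K abs} _.
Arguments nabs_sum_le {R K abs} _.

(* What Ingleton's theorem needs of the scalars [L]. *)
Record spherical_subfield (R : realType) (K : fieldType) (abs : K -> R)
    (L : set K) : Prop := SphericalSubfield {
  ssf1 : L 1;
  ssfB : forall x y, L x -> L y -> L (x - y);
  ssfM : forall x y, L x -> L y -> L (x * y);
  ssfV : forall x, L x -> L x^-1;
  ssf_inter : forall (a : nat -> K) (r : nat -> R),
    (forall n, 0 < r n) -> (forall n, L (a n)) ->
    (forall m n, (m <= n)%N -> r n <= r m /\ abs (a n - a m) <= r m) ->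
    exists2 x, L x & forall n, abs (a n - x) <= r n }.

Arguments ssf1 {R K abs L}.
Arguments ssfB {R K abs L}.
Arguments ssfM {R K abs L}.
Arguments ssfV {R K abs L}.
Arguments ssf_inter {R K abs L}.

Section SphericalSubfield.
Context (R : realType) (K : fieldType) (abs : K -> R) (L : set K).
Context (HL : spherical_subfield R K abs L).

Lemma ssf0 : L 0. Proof. by rewrite -(subrr 1); apply: (ssfB HL); exact: (ssf1 HL). Qed.
Lemma ssfN x : L x -> L (- x).
Proof. by move=> Lx; rewrite -sub0r; apply: (ssfB HL) => //; exact: ssf0. Qed.
Lemma ssfD x y : L x -> L y -> L (x + y).
Proof. by move=> Lx Ly; rewrite -(opprK y); apply: (ssfB HL) => //; exact: ssfN. Qed.
Lemma ssf_nat n : L n%:R.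
Proof.
elim: n => [|n IH]; first exact: ssf0.
by rewrite -natr1; apply: ssfD => //; exact: (ssf1 HL).
Qed.
End SphericalSubfield.

Arguments ssf0 {R K abs L} _.
Arguments ssfD {R K abs L} _.
Arguments ssfN {R K abs L} _.
Arguments ssf_nat {R K abs L} _.

Section Ingleton.
Context (R : realType) (K : fieldType) (abs : K -> R).
Context (Habs : is_nonarch_abs abs) (L : set K).
Context (HL : spherical_subfield R K abs L).

Context (V : lmodType K) (D : set V) (p : V -> R) (M : R) (M0 : 0 <= M).
Context (D0 : D 0).
Context (Dlin : forall a u v, L a -> D u -> D v -> D (a *: u + v)).
Context (p_ge0 : forall u, D u -> 0 <= p u).
Context (pD : forall u v, D u -> D v -> p (u + v) <= Num.max (p u) (p v)).
Context (pZ : forall a u, L a -> D u -> p (a *: u) = abs a * p u).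

(* Partial functionals are represented by their graphs. *)
Definition bounded_graph (Gam : set (V * K^o)) : Prop :=
  [/\ Gam 0, (forall a x y, L a -> Gam x -> Gam y -> Gam (a *: x + y)),
      (forall x, Gam x -> D x.1 /\ L x.2) &
      (forall x, Gam x -> abs x.2 <= M * p x.1)].

Let p0 : p 0 = 0.
Proof.
by rewrite -(scale0r (0 : V)) (pZ _ _ (ssf0 HL) D0) (nabs0 Habs) mul0r.
Qed.

Let DB u v : D u -> D v -> D (u - v).
Proof.
move=> Du Dv; rewrite addrC -scaleN1r; apply: Dlin => //.
by apply: (ssfN HL); exact: (ssf1 HL).
Qed.

Let pN u : D u -> p (- u) = p u.
Proof.
move=> Du; rewrite -scaleN1r pZ //; last by apply: (ssfN HL); exact: (ssf1 HL).
by rewrite (nabsN Habs) (nabs1 Habs) mul1r.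
Qed.

(** The balls with centre [x.2] and radius [M * p (x.1 - v)] meet pairwise, because [x.2 - y.2] is
    controlled by [p (x.1 - y.1)]. Hence they form a chain, and [alpha] is a common point. *)
Lemma best_value (Gam : set (V * K^o)) (v : V) : bounded_graph Gam -> D v ->
  exists2 alpha : K, L alpha &
    forall x, Gam x -> abs (x.2 - alpha) <= M * p (x.1 - v).
Proof.
move=> [G0 Glin GDL Gbd] Dv; pose r (x : V * K^o) := M * p (x.1 - v).
have r_ge0 x : Gam x -> 0 <= r x.
  by move=> /GDL [Dx _]; apply: mulr_ge0 => //; apply: p_ge0; exact: DB.
have pair x y : Gam x -> Gam y -> abs (x.2 - y.2) <= Num.max (r x) (r y).
  move=> Gx Gy; have [Dx _] := GDL _ Gx; have [Dy _] := GDL _ Gy.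
  have Gxy : Gam (- 1 *: y + x).
    by apply: Glin => //; apply: (ssfN HL); exact: (ssf1 HL).
  have E1 : (- 1 *: y + x).1 = x.1 - y.1 by rewrite /= scaleN1r addrC.
  have E2 : (- 1 *: y + x).2 = x.2 - y.2 by rewrite /= scaleN1r addrC.
  have := Gbd _ Gxy; rewrite E1 E2.
  move=> /le_trans; apply; rewrite /r -maxr_pMr//; apply: ler_wpM2l => //.
  have -> : x.1 - y.1 = (x.1 - v) - (y.1 - v) by rewrite opprB addrA subrK.
  apply: (le_trans (pD _ _ _ _)); [exact: DB| |by rewrite pN//; exact: DB].
  by rewrite opprB; exact: DB.
(* If a smallest radius is attained, the centre of that ball lies in all the others. *)
have [[x Gx xmin]|nmin] := pselect (exists2 x, Gam x & forall y, Gam y -> r x <= r y).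
  exists x.2; first by case: (GDL _ Gx).
  move=> y Gy; apply: (le_trans (pair _ _ Gy Gx)).
  by rewrite ge_max lexx /=; apply: xmin.
have smaller x : Gam x -> exists2 y, Gam y & r y < r x.
  move=> Gx; apply: contrapT => h; apply: nmin; exists x => // y Gy.
  by rewrite leNgt; apply/negP => lt; apply: h; exists y.
pose S := [set r x | x in Gam]; pose rho := inf S.
have Sinf : has_inf S.
  split; first by exists (r 0), 0.
  by exists 0 => _ [x Gx <-]; exact: r_ge0.
have rho_le x : Gam x -> rho <= r x.
  by move=> Gx; apply: ge_inf; [exact: Sinf.2|exists x].
have /choice [y Hy] : forall n, exists y, Gam y /\ r y < rho + n.+1%:R^-1.
  move=> n; have [|_ [x Gx <-] lt] := @inf_adherent R S n.+1%:R^-1 _ Sinf.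
    by rewrite invr_gt0 ltr0n.
  by exists x.
(* [x] is the running minimum of the [y n], so its radii decrease to the infimum [rho]. *)
pose x := fix x n := if n is k.+1 then if r (y n) <= r (x k) then y n else x k
                     else y 0%N.
have Gx n : Gam (x n).
  elim: n => [|n IH] /=; first exact: (Hy 0%N).1.
  by case: ifP => _ //; exact: (Hy n.+1).1.
have r_dec n : r (x n.+1) <= r (x n) by rewrite /=; case: ifP.
have r_lt n : r (x n) < rho + n.+1%:R^-1.
  case: n => [|n]; first exact: (Hy 0%N).2.
  rewrite /=; case: ifP => [_|/negbT]; first exact: (Hy n.+1).2.
  by rewrite -ltNge => /lt_trans; apply; exact: (Hy n.+1).2.
have r_mono m n : (m <= n)%N -> r (x n) <= r (x m).
  elim: n => [|n IH]; first by rewrite leqn0 => /eqP->.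
  rewrite leq_eqVlt => /orP[/eqP->//|]; rewrite ltnS => /IH.
  exact: le_trans (r_dec n).
have r_gt0 n : 0 < r (x n).
  have [z Gz lt] := smaller _ (Gx n); exact: le_lt_trans (r_ge0 _ Gz) lt.
have [||m n mn|alpha La Ha] := ssf_inter HL (fun n => (x n).2) (fun n => r (x n)).
- by [].
- by move=> n; case: (GDL _ (Gx n)).
- split; first exact: r_mono.
  apply: (le_trans (pair _ _ (Gx n) (Gx m))).
  by rewrite ge_max lexx andbT; exact: r_mono.
(* As no radius is minimal, [r z] exceeds [rho], so some ball of the sequence is no larger than that
   of [z] and lies inside it. *)
exists alpha => // z Gz; have [w Gw wz] := smaller z Gz.
have rz : 0 < r z - rho by rewrite subr_gt0; exact: le_lt_trans (rho_le _ Gw) wz.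
have [n Hn] : exists n, n.+1%:R^-1 <= r z - rho.
  exists (Num.truncn (r z - rho)^-1).
  rewrite invf_ple ?posrE ?ltr0n//; apply: ltW; exact: truncnS_gt.
have rn : r (x n) <= r z.
  by apply: ltW; apply: (lt_le_trans (r_lt n)); rewrite -lerBrDl.
apply: (nabsB_le Habs _ (x n).2).
  by apply: (le_trans (pair _ _ Gz (Gx n))); rewrite ge_max lexx.
exact: le_trans (Ha n) rn.
Qed.

(** The new value at [v] is the [alpha] of [best_value]. Dividing by [-a] reduces the bound at
    [x + a v] to the choice of [alpha], applied to [-a^-1 x]. *)
Lemma bounded_graph_extend (Gam : set (V * K^o)) (v : V) :
  bounded_graph Gam -> D v ->
  exists Gam', [/\ bounded_graph Gam', Gam `<=` Gam' & exists c, Gam' (v, c)].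
Proof.
move=> bG Dv; have [alpha La Ha] := best_value Gam v bG Dv.
have [G0 Glin GDL Gbd] := bG.
exists [set z | exists x a, [/\ Gam x, L a & z = x + a *: ((v, alpha) : V * K^o)]].
split; last 2 first.
- by move=> x Gx; exists x, 0; rewrite scale0r addr0; split => //; exact: (ssf0 HL).
- by exists alpha, 0, 1; rewrite scale1r add0r; split => //; exact: (ssf1 HL).
split.
- by exists 0, 0; rewrite scale0r addr0; split => //; exact: (ssf0 HL).
- move=> a _ _ Ln [x [b [Gx Lb ->]]] [y [c [Gy Lc ->]]].
  exists (a *: x + y), (a * b + c); split; first exact: Glin.
    by apply: (ssfD HL) => //; apply: (ssfM HL).
  by rewrite scalerDr scalerDl scalerA addrACA.
- move=> _ [x [a [Gx Ln ->]]]; have [Dx Lx] := GDL _ Gx; split.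
    by rewrite /= addrC; apply: Dlin.
  by apply: (ssfD HL) => //; apply: (ssfM HL).
- move=> _ [x [a [Gx Ln ->]]]; have [a0|a0] := eqVneq a 0.
    by rewrite a0 scale0r addr0; exact: Gbd.
  have [Dx Lx] := GDL _ Gx; pose y := (- a^-1) *: x.
  have Gy : Gam y.
    rewrite -[y]addr0; apply: Glin => //; apply: (ssfN HL); exact: (ssfV HL).
  have [Dy Ly] := GDL _ Gy.
  have E : x + a *: ((v, alpha) : V * K^o) = (- a) *: (y - (v, alpha)).
    by rewrite scalerBr scalerA mulrNN mulfV// scale1r scaleNr opprK.
  rewrite E [X in abs X](_ : _ = (- a) * (y.2 - alpha)) // (nabsM Habs).
  rewrite [X in p X](_ : _ = (- a) *: (y.1 - v)) // pZ; [|exact: (ssfN HL)|exact: DB].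
  by rewrite mulrCA; apply: ler_wpM2l; [exact: (nabs_ge0 Habs)|exact: Ha].
Qed.

Lemma ingleton (Gam0 : set (V * K^o)) : bounded_graph Gam0 ->
  exists m : V -> K, [/\ (forall x, Gam0 x -> m x.1 = x.2),
    (forall u, D u -> L (m u)),
    (forall a u v, L a -> D u -> D v -> m (a *: u + v) = a * m u + m v) &
    (forall u, D u -> abs (m u) <= M * p u)].
Proof.
move=> b0; pose P Gam := Gam = set0 \/ (bounded_graph Gam /\ Gam0 `<=` Gam).
have [|A [PA Amax]] := @Zorn_bigcup _ P.
  move=> F FP Ftot; have [[G1 FG1 [x0 G1x0]]|nF] :=
    pselect (exists2 B, F B & B !=set0); last first.
    left; rewrite -subset0 => x [B FB Bx]; apply: nF; exists B => //; exists x.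
    exact: Bx.
  have Fb B x : F B -> B x -> bounded_graph B.
    by move=> /FP [->|[]].
  right; split; last first.
    move=> x /=; have [G10|[_ sub]] := FP _ FG1; first by rewrite G10 in G1x0.
    by move=> /sub; exists G1.
  split.
  - by exists G1 => //; case: (Fb _ _ FG1 G1x0).
  - move=> a x y Ln [B FB Bx] [C FC Cy].
    have [BC|CB] := Ftot _ _ FB FC.
      exists C => //; have [_ lin _ _] := Fb _ _ FC Cy; apply: lin => //; exact: BC.
    exists B => //; have [_ lin _ _] := Fb _ _ FB Bx; apply: lin => //; exact: CB.
  - by move=> x [B FB Bx]; have [_ _ h _] := Fb _ _ FB Bx; exact: h.
  - by move=> x [B FB Bx]; have [_ _ _ h] := Fb _ _ FB Bx; exact: h.
have [bA sub] : bounded_graph A /\ Gam0 `<=` A.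
  case: PA => // A0; exfalso; apply: (Amax Gam0); last by right; split.
  rewrite A0; split; first exact: sub0set.
  by case: b0 => G0 _ _ _ h; exact: (h _ G0).
have Atot u : D u -> exists c, A (u, c).
  move=> Du; have [B [bB AB [c Bc]]] := bounded_graph_extend A u bA Du.
  exists c; apply: contrapT => nA; apply: (Amax B); last first.
    by right; split => //; exact: subset_trans AB.
  by split => // BA; apply: nA; apply: BA.
have [A0 Alin ADL Abd] := bA.
(* Single-valuedness follows from the bound: the difference of two values at [u] lies over [0],
   where [p] vanishes. *)
have Auniq u c c' : A (u, c) -> A (u, c') -> c = c'.
  move=> Ac Ac'; have /Abd : A (-1 *: (u, c') + (u, c)).
    by apply: Alin => //; apply: (ssfN HL); exact: (ssf1 HL).
  rewrite /= scaleN1r addNr p0 mulr0 => h.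
  have /eqP : abs (-1 *: c' + c) = 0.
    by apply/eqP; rewrite eq_le h; exact: (nabs_ge0 Habs).
  by rewrite (nabs_eq0 Habs) scaleN1r addrC subr_eq0 => /eqP.
pose m u := xget 0 [set c | A (u, c)].
have mP u : D u -> A (u, m u).
  by move=> /Atot [c Ac]; apply: (@xgetPex _ 0 [set c | A (u, c)]); exists c.
exists m; split.
- move=> [u c] /sub Auc; have [Du _] := ADL _ Auc.
  exact: Auniq (mP u Du) Auc.
- by move=> u /mP /ADL [].
- move=> a u v Ln Du Dv; apply: (Auniq (a *: u + v)); first by apply: mP; exact: Dlin.
  exact: (Alin a (u, m u) (v, m v) Ln (mP u Du) (mP v Dv)).
- by move=> u /mP /Abd.
Qed.

End Ingleton.

(** * Flows on infinite orbits *)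

Section Flow.
Local Open Scope nat_scope.
Context (I X : choiceType) (S : seq I) (iota : I -> I) (act : I -> X -> X).
Context (iotaS : forall i, i \in S -> iota i \in S).
Context (actK : forall i x, act (iota i) (act i x) = x).
Context (actVK : forall i x, act i (act (iota i) x) = x).

(** [sg] chooses at most one outgoing edge at each vertex; the value at [x] is the amount of [phi]
    that flows into [x] along chosen edges. *)
Definition push_flow (sg : X -> option I) (phi : X -> nat) (x : X) : nat :=
  \sum_(i <- S | sg (act (iota i) x) == Some i) phi (act (iota i) x).

(** The number of paths of length [k] along chosen edges that end at a given vertex. *)
Definition ancestors sg k : X -> nat := iter k (push_flow sg) (fun _ => 1).

Definition fin_ancestors sg x := exists k, ancestors sg k x = 0.

Lemma push_flow_eq0 sg phi x : push_flow sg phi x = 0 <->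
  forall i, i \in S -> sg (act (iota i) x) = Some i -> phi (act (iota i) x) = 0.
Proof.
rewrite /push_flow; split=> [/eqP|H].
  rewrite sum_nat_seq_eq0 => /allP H i /H /implyP h /eqP /h /eqP //.
by rewrite big_seq_cond big1 // => i /andP[iS /eqP]; exact: H.
Qed.

Lemma push_flow_ge sg phi i x : i \in S -> sg x = Some i -> 0 < phi x ->
  0 < push_flow sg phi (act i x).
Proof.
move=> iS sgx phx; rewrite lt0n; apply/eqP => /push_flow_eq0 /(_ i iS).
by rewrite actK => /(_ sgx) h; rewrite h in phx.
Qed.

Lemma ancestorsS sg k x : ancestors sg k x = 0 -> ancestors sg k.+1 x = 0.
Proof.
elim: k x => // k IH x /push_flow_eq0 H; apply/push_flow_eq0 => i iS sgi.
by apply: IH; exact: H.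
Qed.

Lemma ancestors_ge sg k n x : k <= n -> ancestors sg k x = 0 ->
  ancestors sg n x = 0.
Proof.
move=> /subnKC <-; elim: (n - k) => [|m IH] h; first by rewrite addn0.
by rewrite addnS; apply/ancestorsS/IH.
Qed.

(** Koenig's step: only finitely many edges enter [x], so the maximum of the bounds for their
    sources, plus one, is a bound for [x]. *)
Lemma fin_ancestorsP sg x :
  (forall i, i \in S -> sg (act (iota i) x) = Some i ->
     fin_ancestors sg (act (iota i) x)) -> fin_ancestors sg x.
Proof.
move=> H; suff [k Hk] : exists k, forall i, i \in S ->
    sg (act (iota i) x) = Some i -> ancestors sg k (act (iota i) x) = 0.
  by exists k.+1; apply/push_flow_eq0.
elim: S H => [|i s IH] H; first by exists 0.
have [|k Hk] := IH; first by move=> j js; apply: H; rewrite inE js orbT.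
have [k' Hk'] : exists k', sg (act (iota i) x) = Some i ->
    ancestors sg k' (act (iota i) x) = 0.
  have [/(H i (mem_head _ _)) [k' ?]|] := pselect (sg (act (iota i) x) = Some i).
    by exists k'.
  by exists 0.
exists (maxn k k') => j; rewrite inE => /orP[/eqP->|js] sgj.
  by apply: (ancestors_ge _ k'); [exact: leq_maxr|exact: Hk'].
by apply: (ancestors_ge _ k); [exact: leq_maxl|exact: Hk].
Qed.

(** [F x] counts all chosen paths ending at [x], the trivial one included. The identity is the flow
    equation: every vertex adds one unit to what flows in. *)
Lemma ancestor_count sg : (forall x, fin_ancestors sg x) ->
  exists F : X -> nat, forall x, F x = 1 + push_flow sg F x.
Proof.
move=> /choice [k Hk]; exists (fun x => \sum_(j < k x) ancestors sg j x) => x.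
have Fge n y : k y <= n ->
    \sum_(j < k y) ancestors sg j y = \sum_(j < n) ancestors sg j y.
  move=> kn; rewrite (big_ord_widen _ (fun j => ancestors sg j y) kn).
  rewrite big_mkcond; apply: eq_bigr => j _; case: ltnP => // h.
  by rewrite (ancestors_ge _ (k y) j).
(* [N] dominates the cutoffs of [x] and of its neighbours, so all the sums can be cut at a common
   length. *)
pose N := k x + \sum_(i <- S) k (act (iota i) x).
rewrite (Fge N.+1); last by rewrite ltnW// ltnS leq_addr.
rewrite big_ord_recl; congr (_ + _); rewrite /push_flow exchange_big /=.
rewrite big_seq_cond [RHS]big_seq_cond; apply: eq_bigr => i /andP[iS _].
rewrite (Fge N) // /N (big_rem _ iS) /= addnCA; exact: leq_addr.
Qed.

Fixpoint reach n x : seq X :=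
  if n is k.+1 then [seq act i y | i <- S, y <- reach k x] else [:: x].

Lemma reach_actr n i x y : i \in S -> y \in reach n x -> act i y \in reach n.+1 x.
Proof. by move=> iS yb; apply/allpairsP; exists (i, y). Qed.

Lemma reach_actl n i x y : i \in S -> y \in reach n (act i x) -> y \in reach n.+1 x.
Proof.
move=> iS; elim: n y => [|n IH] y.
  by rewrite inE => /eqP->; apply: (reach_actr 0) => //; exact: mem_head.
by move=> /allpairsP [[j z] /= [jS zb ->]]; apply: (reach_actr n.+1) => //; exact: IH.
Qed.

Lemma reach_sym n x y : y \in reach n x -> x \in reach n y.
Proof.
elim: n y => [|n IH] y; first by rewrite !inE eq_sym.
move=> /allpairsP [[i z] /= [iS zb ->]].
by apply: (reach_actl n (iota i)); [exact: iotaS|rewrite actK; exact: IH].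
Qed.

Lemma reach_trans m n x y z : y \in reach m x -> z \in reach n y ->
  z \in reach (n + m) x.
Proof.
move=> yb; elim: n z => [|n IH] z; first by rewrite inE => /eqP->.
by move=> /allpairsP [[i w] /= [iS wb ->]]; apply: reach_actr => //; exact: IH.
Qed.

Definition orb x : set X := [set y | exists n, y \in reach n x].

Lemma orb_refl x : orb x x. Proof. by exists 0; exact: mem_head. Qed.

Lemma orb_eq x y : orb x y -> orb x = orb y.
Proof.
move=> [m yb]; apply/seteqP; split=> z [n zb].
  by exists (n + m); apply: (reach_trans m n y x); [exact: reach_sym|].
by exists (n + m); apply: reach_trans zb.
Qed.

(* Root each orbit and take a breadth-first spanning tree, with [sp] pointing
   towards the root.  The flow [sg] leaves a vertex with finitely many
   descendants towards its parent, and any other vertex towards a child with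
   infinitely many descendants (which exists by Koenig's argument). *)
Lemma orbit_flow : exists (sg : X -> option I) (F : X -> nat),
  (forall x, F x = 1 + push_flow sg F x) /\
  (forall x, ~ (exists t : seq X, forall y, orb x y -> y \in t) ->
     exists2 i, i \in S & sg x = Some i).
Proof.
have [[x0]|nX] := pselect (inhabited X); last first.
  exists (fun=> None), (fun=> 0).
  by split=> x; exfalso; apply: nX.
pose base x := xget x0 (orb x).
have orb_base x : orb x (base x) by apply: (@xgetPex _ x0); exists x; exact: orb_refl.
have base_eq x y : orb x y -> base y = base x by move=> /orb_eq h; rewrite /base h.
have ex_depth x : exists n, x \in reach n (base x).
  by have [n nb] := orb_base x; exists n; exact: reach_sym.
pose depth x := ex_minn (ex_depth x).
have depthP x : x \in reach (depth x) (base x) by rewrite /depth; case: ex_minnP.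
have depth_le x n : x \in reach n (base x) -> depth x <= n.
  by rewrite /depth; case: ex_minnP => m _ h /h.
have orb_act i x : i \in S -> orb x (act i x).
  by move=> iS; exists 1; apply: (reach_actr 0) => //; exact: mem_head.
have depth_act i x : i \in S -> depth (act i x) <= (depth x).+1.
  move=> iS; apply: depth_le; rewrite (base_eq x); last exact: orb_act.
  exact: reach_actr.
have /choice [sp Hsp] : forall x, exists o : option I,
    (depth x = 0 -> o = None) /\ (forall k, depth x = k.+1 ->
      exists2 i, i \in S & o = Some i /\ depth (act i x) = k).
  move=> x; case E : (depth x) => [|k]; first by exists None; split.
  have := depthP x; rewrite E => /allpairsP [[i z] /= [iS zb xE]].
  exists (Some (iota i)); split=> // k' [<-]; exists (iota i); first exact: iotaS.
  split=> //; rewrite xE actK; have bz : base z = base x.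
    by rewrite xE; symmetry; apply: base_eq; exact: orb_act.
  apply/eqP; rewrite eqn_leq depth_le ?bz//=.
  by rewrite -ltnS -E xE; exact: depth_act.
have spS x i : sp x = Some i -> i \in S /\ depth x = (depth (act i x)).+1.
  have [h0 h1] := Hsp x; case E : (depth x) => [|k]; first by rewrite h0.
  by have [j jS [-> <-]] := h1 k E => -[<-].
(* Following [sp] for [j] steps from [z] leads to a vertex [w] that has an ancestor at level [j],
   namely [z]. *)
have climb j z : j <= depth z -> exists w, [/\ 0 < ancestors sp j w,
    depth w = depth z - j & base w = base z].
  elim: j => [|j IH] jz; first by exists z; rewrite subn0.
  have [w [pw dw bw]] := IH (ltnW jz).
  have [_ /(_ (depth z - j.+1))] := Hsp w; rewrite dw -subSn // subSS.
  case=> // i iS [spi di]; exists (act i w); split=> //.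
    exact: push_flow_ge.
  by rewrite -bw; apply: base_eq; exact: orb_act.
(* If the root had no ancestor at level [k], all depths in its orbit would be below [k], and the
   orbit would be covered by finitely many finite sets [reach n]. *)
have root_inf x : ~ (exists t : seq X, forall y, orb x y -> y \in t) ->
    depth x = 0 -> ~ fin_ancestors sp x.
  move=> infx dx [k Hk]; apply: infx.
  exists (flatten [seq reach n (base x) | n <- seq.iota 0 k]) => y oy.
  have [ky|yk] := leqP k (depth y).
    have [w [pw dw bw]] := climb _ _ (leqnn (depth y)).
    have wx : w = x.
      have := depthP w; rewrite dw subnn inE => /eqP ->.
      have := depthP x; rewrite dx inE => /eqP ->.
      by rewrite bw (base_eq x).
    by move: pw; rewrite wx (ancestors_ge _ k).
  apply/flattenP; exists (reach (depth y) (base x)).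
    by apply: map_f; rewrite mem_iota.
  by rewrite -(base_eq x y oy); exact: depthP.
have /choice [sg Hsg] : forall x, exists o : option I,
    (fin_ancestors sp x -> o = sp x) /\ (~ fin_ancestors sp x ->
      exists2 i, i \in S & [/\ o = Some (iota i), sp (act (iota i) x) = Some i &
        ~ fin_ancestors sp (act (iota i) x)]).
  move=> x; have [fx|nfx] := pselect (fin_ancestors sp x); first by exists (sp x).
  suff [i iS [h1 h2]] : exists2 i, i \in S & sp (act (iota i) x) = Some i /\
      ~ fin_ancestors sp (act (iota i) x).
    by exists (Some (iota i)); split=> // _; exists i.
  apply: contrapT => h; apply: nfx; apply: fin_ancestorsP => i iS spi.
  by apply: contrapT => h'; apply: h; exists i.
(* Reversed edges point to vertices of infinite ancestry, so an [sg] edge into a vertex of finite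
   [sp]-ancestry is an [sp] edge. *)
have sg_fin k x : ancestors sp k x = 0 -> ancestors sg k x = 0.
  elim: k x => // k IH x Hx; apply/push_flow_eq0 => i iS sgi.
  have [h1 h2] := Hsg (act (iota i) x).
  have [fy|/h2 [j jS [E _]]] := pselect (fin_ancestors sp (act (iota i) x)).
    by apply: IH; apply: (iffLR (push_flow_eq0 _ _ _) Hx) => //; rewrite -h1.
  by move: E; rewrite sgi => -[<-]; rewrite actVK => -[]; exists k.+1.
(* An [sg] edge into [x] from a vertex of infinite [sp]-ancestry starts at the parent of [x], which
   has smaller depth. *)
have sg_good d x : depth x = d -> fin_ancestors sg x.
  elim/ltn_ind: d x => d IH x dx; apply: fin_ancestorsP => i iS sgi.
  have [h1 h2] := Hsg (act (iota i) x).
  have [[k Hk]|/h2 [j jS [E spj _]]] := pselect (fin_ancestors sp (act (iota i) x)).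
    by exists k; exact: sg_fin.
  move: E spj; rewrite sgi => -[E]; rewrite -E actVK => /spS [_ dj].
  have E' : act (iota i) x = act j x.
    by rewrite -[LHS](actVK j) -E actVK.
  by rewrite E'; apply: (IH (depth (act j x))) => //; rewrite -dx dj.
have [F HF] := ancestor_count sg (fun x => sg_good _ x erefl).
exists sg, F; split=> // x infx; have [h1 h2] := Hsg x.
have [fx|/h2 [j jS [-> _ _]]] := pselect (fin_ancestors sp x); last first.
  by exists (iota j) => //; exact: iotaS.
rewrite (h1 fx); have [_ hs] := Hsp x.
(* Only a root lacks an [sp] edge, and the root of an infinite orbit has infinite ancestry. *)
case E : (depth x) => [|k]; first by case: (root_inf x infx E).
by have [i iS [-> _]] := hs k E; exists i.
Qed.

End Flow.

(** * Invariant means *)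

Section Means.
Context (G : topologicalType) (mul : G -> G -> G) (inv : G -> G) (e : G).
Context (HG : is_topgroup mul inv e).
Context (R : realType) (K : fieldType) (abs : K -> R).
Context (Habs : is_nonarch_abs abs) (L : set K).
Context (HL : spherical_subfield R K abs L).
Local Infix "**" := mul (at level 40, left associativity).
Local Notation osubgrp := (open_subgroup mul inv e).
Local Notation CbL := (@Cb G R K abs L).
Local Notation snorm := (@supnorm G R K abs).

Lemma Cb_bounded f : CbL f -> exists M, forall x, abs (f x) <= M.
Proof. by move=> [_ []]. Qed.

Lemma Cb_locally_constant f M : (forall x, L (f x)) ->
  (forall x, abs (f x) <= M) ->
  (forall x, exists U : set G, [/\ open U, U x & forall y, U y -> f y = f x]) ->
  CbL f.
Proof.
move=> Lf fM loc; split=> //; split; first by exists M.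
move=> x eps eps0; have [U [oU Ux Uf]] := loc x; exists U; split=> // y /Uf ->.
by rewrite subrr (nabs0 Habs).
Qed.

Lemma Cb_cst c : L c -> CbL (fun _ => c).
Proof.
move=> Lc; apply: (Cb_locally_constant _ (abs c)) => // x.
by exists setT; split=> //; exact: openT.
Qed.

Lemma Cb_lin a f g : L a -> CbL f -> CbL g -> CbL (fun x => a * f x + g x).
Proof.
move=> La [Lf [[M fM] cf]] [Lg [[N gN] cg]]; split.
  by move=> x; apply: (ssfD HL) => //; apply: (ssfM HL).
split.
  exists (Num.max (abs a * M) N) => x.
  apply: (nabsD_le Habs); rewrite le_max ?gN ?orbT// (nabsM Habs).
  by rewrite ler_wpM2l ?(nabs_ge0 Habs).
move=> x eps eps0; have a1 : 0 < abs a + 1.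
  by rewrite ltr_pwDr// (nabs_ge0 Habs).
have [U [oU Ux Uf]] := cf x (eps / (abs a + 1)) (divr_gt0 eps0 a1).
have [V [oV Vx Vg]] := cg x eps eps0.
exists (U `&` V); split; [exact: openI|by []|move=> y [Uy Vy]].
have -> : a * f y + g y - (a * f x + g x) = a * (f y - f x) + (g y - g x) by ring.
apply: (le_lt_trans (abs_ultra Habs _ _)); rewrite gt_max Vg// andbT.
rewrite (nabsM Habs); apply: (@le_lt_trans _ _ (abs a * (eps / (abs a + 1)))).
  by apply: ler_wpM2l; [exact: (nabs_ge0 Habs)|apply/ltW/Uf].
by rewrite mulrA ltr_pdivrMr// mulrC ltr_pM2l// ltrDl.
Qed.

Lemma CbD f g : CbL f -> CbL g -> CbL (f \+ g).
Proof.
move=> Cf Cg; have := Cb_lin 1 f g (ssf1 HL) Cf Cg.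
by congr Cb; apply/funext => x /=; rewrite mul1r.
Qed.

Lemma Cb_trans h f : CbL f -> CbL (fun x => f (h ** x)).
Proof.
move=> [Lf [[M fM] cf]]; split; [by []|split; first by exists M].
move=> x eps eps0; have [U [oU Ux Uf]] := cf (h ** x) eps eps0.
exists [set y | U (h ** y)]; split=> //; last by move=> y; exact: Uf.
exact: (open_mull HG).
Qed.

Lemma Cb_sum (I : Type) (s : seq I) (F : I -> G -> K) : (forall i, CbL (F i)) ->
  CbL (fun x => \sum_(i <- s) F i x).
Proof.
move=> CF; elim: s => [|i s IH].
  rewrite [X in Cb _ _ X](_ : _ = fun=> 0).
    by apply: Cb_cst; exact: (ssf0 HL).
  by apply/funext => x; rewrite big_nil.
rewrite [X in Cb _ _ X](_ : _ = F i \+ (fun x => \sum_(i <- s) F i x)).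
  exact: CbD.
by apply/funext => x; rewrite big_cons.
Qed.

Lemma supnorm_ge f x : CbL f -> abs (f x) <= snorm f.
Proof.
move=> /Cb_bounded [M fM]; apply: ub_le_sup; last by exists x.
by exists M => _ [y _ <-].
Qed.

Lemma supnorm_le f M : (forall x, abs (f x) <= M) -> snorm f <= M.
Proof.
move=> fM; apply: ge_sup; first by exists (abs (f e)), e.
by move=> _ [x _ <-].
Qed.

Lemma supnorm_ge0 f : CbL f -> 0 <= snorm f.
Proof. by move=> /(supnorm_ge _ e); apply: le_trans; exact: (nabs_ge0 Habs). Qed.

Lemma supnormD f g : CbL f -> CbL g ->
  snorm (f \+ g) <= Num.max (snorm f) (snorm g).
Proof.
move=> Cf Cg; apply: supnorm_le => x; apply: (nabsD_le Habs).
  by rewrite le_max supnorm_ge.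
by rewrite le_max (supnorm_ge _ _ Cg) orbT.
Qed.

Lemma supnormZ_le a f : L a -> CbL f -> snorm (fun x => a * f x) <= abs a * snorm f.
Proof.
move=> La Cf; apply: supnorm_le => x; rewrite (nabsM Habs).
by apply: ler_wpM2l; [exact: (nabs_ge0 Habs)|exact: supnorm_ge].
Qed.

Lemma CbZ a f : L a -> CbL f -> CbL (fun x => a * f x).
Proof.
move=> La Cf; have L0 := ssf0 HL.
have := Cb_lin a f _ La Cf (Cb_cst 0 L0).
by congr Cb; apply/funext => x; rewrite addr0.
Qed.

Lemma supnormZ a f : L a -> CbL f -> snorm (fun x => a * f x) = abs a * snorm f.
Proof.
move=> La Cf; apply/eqP; rewrite eq_le supnormZ_le//=.
have [->|a0] := eqVneq a 0.
  rewrite (nabs0 Habs) mul0r; apply: supnorm_ge0.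
  by apply: CbZ => //; exact: (ssf0 HL).
have a_gt0 : 0 < abs a by rewrite (nabs_gt0 Habs).
(* The reverse inequality is the one already known, applied to [a^-1] and [a f]. *)
rewrite -ler_pdivlMl// -(nabsV Habs).
have := supnormZ_le a^-1 _ (ssfV HL _ La) (CbZ _ _ La Cf).
congr (_ <= _); congr supnorm; apply/funext => x; first by rewrite mulKf.
Qed.

(** * Consequences of an invariant mean *)

Section Invariant.
Context (m : (G -> K) -> K) (Hm : invariant_mean abs L mul inv m).

Lemma mean_sum (I : Type) (s : seq I) (F : I -> G -> K) : (forall i, CbL (F i)) ->
  m (fun x => \sum_(i <- s) F i x) = \sum_(i <- s) m (F i).
Proof.
have [[_ mD mZ _ _] _] := Hm; have L0 := ssf0 HL.
move=> CF; elim: s => [|i s IH].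
  rewrite big_nil -[RHS](mul0r (m (fun=> 0))) -mZ//; last exact: Cb_cst.
  by congr m; apply/funext => x; rewrite big_nil mul0r.
rewrite big_cons -IH -mD//; last exact: Cb_sum.
by congr m; apply/funext => x; rewrite big_cons.
Qed.

Lemma mean_trans_sum (s : seq G) (F : G -> G -> K) : (forall i, CbL (F i)) ->
  m (fun x => \sum_(i <- s) F i (inv i ** x)) = \sum_(i <- s) m (F i).
Proof.
have [_ minv] := Hm; move=> CF.
rewrite (mean_sum _ s (fun i x => F i (inv i ** x))); last first.
  by move=> i; exact: Cb_trans.
by apply: eq_bigr => i _; exact: minv.
Qed.

Lemma mean_index_bound C : (forall f, CbL f -> abs (m f) <= C * snorm f) ->
  forall U V k, osubgrp U -> osubgrp V -> V `<=` U ->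
    index_is mul inv U V k -> 1 <= C * abs k%:R.
Proof.
move=> mC U V k oU oV VU [s [sk us sU cov sep]].
have [[[Ue [UM Ui]] _] [[Ve [VM Vi]] _]] := (oU, oV).
have C0 : 0 <= C.
  have [[_ _ _ _ m1] _] := Hm.
  have := mC _ (Cb_cst 1 (ssf1 HL)); rewrite m1 (nabs1 Habs).
  move=> h; rewrite leNgt; apply/negP => Cn.
  have : C * snorm (fun=> 1) <= 0.
    apply: mulr_le0_ge0; [exact: ltW|apply: supnorm_ge0].
    by apply: Cb_cst; exact: (ssf1 HL).
  by move=> /(le_trans h); rewrite ler10.
(* [t] picks representatives of the right cosets [U x]; [f] is the indicator
   function of [V t(G)], whose translates by [s] partition [G]. *)
pose t x := xget e [set y | U (x ** inv y)].
have tP x : U (x ** inv (t x)).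
  apply: (@xgetPex _ e [set y | U (x ** inv y)]); exists x.
  by rewrite /= (tgmulgV HG).
have tU u x : U u -> t (u ** x) = t x.
  move=> Uu; rewrite /t; congr xget; apply/seteqP; split=> y /=.
    move=> /(UM _ _ (Ui _ Uu)).
    by rewrite -(tgmulgA HG) (tgmulKg HG).
  by move=> /(UM _ _ Uu); rewrite (tgmulgA HG).
pose A x := V (x ** inv (t x)).
have AV v x : V v -> A (v ** x) <-> A x.
  move=> Vv; rewrite /A tU; last exact: VU.
  rewrite -(tgmulgA HG); split; last exact: VM.
  by move=> /(VM _ _ (Vi _ Vv)); rewrite (tgmulKg HG).
pose f x : K := if `[< A x >] then 1 else 0.
have L0 := ssf0 HL; have L1 := ssf1 HL.
have f1 x : abs (f x) <= 1.
  by rewrite /f; case: ifP; rewrite ?(nabs1 Habs) ?(nabs0 Habs).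
have Cf : CbL f.
  apply: (Cb_locally_constant _ 1) => // x; first by rewrite /f; case: ifP.
  exists [set y | V (y ** inv x)]; split.
  - by apply: (open_mulr HG); case: oV.
  - by rewrite /= (tgmulgV HG).
  - move=> y Vy; rewrite /f -(tgmulgKV HG x y).
    by congr (if _ then _ else _); apply/asbool_equiv_eq/AV.
(* [x (t x)^-1] lies in [U], hence in exactly one coset [i V] with [i] in [s]. *)
have part x : \sum_(i <- s) f (inv i ** x) = 1.
  have fE i : i \in s -> f (inv i ** x) =
      if `[< V (inv i ** (x ** inv (t x))) >] then 1 else 0.
    move=> /sU Ui'; rewrite /f /A tU; last exact: Ui.
    by rewrite (tgmulgA HG).
  have [i si Vi'] := cov _ (tP x).
  rewrite (bigD1_seq i)//= fE// asboolT// big_seq_cond big1 ?addr0//.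
  move=> j /andP[sj ji]; rewrite fE//; case: ifP => // /asboolP Vj.
  case/eqP: ji; apply: sep => //.
  apply: (subgrpT HG _ _ (x ** inv (t x)) _ oV.1) => //.
  exact: (subgrpVM HG _ _ _ oV.1).
have [[_ _ _ _ m1] _] := Hm.
have km : k%:R * m f = 1.
  transitivity (\sum_(i <- s) m f).
    by rewrite big_const_seq count_predT sk iter_addr_0 mulr_natl.
  by rewrite -[RHS]m1 -(mean_trans_sum s (fun=> f))//; congr m; apply/funext.
have E : abs (m f) * abs k%:R = 1.
  by rewrite -(nabsM Habs) mulrC km (nabs1 Habs).
apply: (@le_trans _ _ (abs (m f) * abs k%:R)); first by rewrite E.
apply: ler_wpM2r; first exact: (nabs_ge0 Habs).
apply: (le_trans (mC f Cf)); rewrite -[leRHS]mulr1.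
by apply: ler_wpM2l => //; exact: supnorm_le.
Qed.

Lemma mean_locally_elliptic : totally_disconnected [set: G] ->
  locally_compact [set: G] -> locally_elliptic mul inv e.
Proof.
(* [S] is symmetric, as the flow requires, and free of repetitions, so that each vertex contributes
   exactly one outgoing term. *)
move=> Htd Hlc S0; pose S := undup (S0 ++ map inv S0).
have SV i : i \in S -> inv i \in S.
  rewrite !mem_undup !mem_cat => /orP[iS|/mapP[j jS ->]].
    by rewrite map_f ?orbT.
  by rewrite (tginvgK HG) jS.
have [U [oU cU _]] := van_dantzig HG Htd Hlc setT filterT.
have [[Ue [UM Ui]] opU] := oU.
pose act (g : G) (A : set G) : set G := [set y | A (inv g ** y)].
pose coset x : set G := [set y | U (inv x ** y)].
have actK g A : act (inv g) (act g A) = A.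
  apply/seteqP; split=> y; rewrite /act /= (tginvgK HG) (tgmulKg HG)//.
have actVK g A : act g (act (inv g) A) = A.
  apply/seteqP; split=> y; rewrite /act /= (tginvgK HG) (tgmulKVg HG)//.
have act_coset g x : act g (coset x) = coset (g ** x).
  by apply/seteqP; split=> y; rewrite /act /coset /= (tginvMg HG) (tgmulgA HG).
have cosetM x u : U u -> coset (x ** u) = coset x.
  move=> Uu; apply/seteqP; split=> y; rewrite /coset /= (tginvMg HG) -(tgmulgA HG).
    by move=> /(UM _ _ Uu); rewrite (tgmulKVg HG).
  exact/UM/Ui.
have coset_refl x : coset x x by rewrite /coset /= (tgmulVg HG).
pose finorb A := exists t : seq (set G), forall B, orb G (set G) S act A B -> B \in t.
(* A finite orbit of cosets has a compact open union [O]. Its translate [W = O x^-1] contains [e],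
   and the stabiliser of [W] contains [S]. *)
have [[x [t Ht]]|ninf] := pselect (exists x, finorb (coset x)).
  pose OO := orb G (set G) S act (coset x).
  have OOact g A : g \in S -> OO A -> OO (act g A).
    by move=> gS [n nA]; exists n.+1; exact: reach_actr.
  have OOcoset A : OO A -> exists y, A = coset y.
    move=> [n]; elim: n A => [|n IH] A; first by rewrite inE => /eqP ->; exists x.
    move=> /allpairsP [[g B] /= [gS Bb ->]]; have [y ->] := IH _ Bb.
    by exists (g ** y).
  pose O : set G := \bigcup_(A in OO) A.
  have oO : open O.
    apply: bigcup_open => _ /OOcoset [y ->]; exact: (open_mull HG).
  have cO : compact O.
    have -> : O = \bigcup_(A in [set` [seq A <- t | `[< OO A >]]]) A.
      apply/seteqP; split=> y [A] /=.
        by move=> oA Ay; exists A => //=; rewrite mem_filter Ht ?andbT//; apply/asboolP.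
      by rewrite mem_filter => /andP[/asboolP oA _] Ay; exists A.
    rewrite bigcup_seq big_filter; apply: bigsetU_compact => A /asboolP /OOcoset [y ->].
    exact: (compact_mull HG).
  pose W : set G := [set z | O (z ** x)].
  have We : W e.
    by rewrite /W /= (tgmul1g HG); exists (coset x) => //; exact: orb_refl.
  have cW : compact W by exact: (compact_mulr HG).
  have oW : open W by exact: (open_mulr HG).
  exists (stab G mul inv W); split; first exact: (stab_subgrp HG).
  split; first exact: (stab_compact HG).
  have SW g w : g \in S -> W w -> W (g ** w).
    move=> gS [A oA Aw]; exists (act g A); first exact: OOact.
    by rewrite /act /= -(tgmulgA HG) (tgmulKg HG).
  move=> g gS0 w Ww; have gS : g \in S by rewrite mem_undup mem_cat gS0.
  by split; apply: SW => //; exact: SV.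
have [sg [F [HF Hsg]]] := orbit_flow G (set G) S inv act SV actK actVK.
have L0 := ssf0 HL.
(* [F] may be unbounded, but integers have absolute value at most one. The inflow is a sum of
   translates of the [fi] and the outflow is the sum of the [fi], so invariance yields
   [m f = 1 + m f]. *)
pose f x : K := (F (coset x))%:R.
pose fi i x : K := if sg (coset x) == Some i then f x else 0.
have Cfi i : CbL (fi i).
  apply: (Cb_locally_constant _ 1) => x.
  - by rewrite /fi; case: ifP => // _; exact: (ssf_nat HL).
  - by rewrite /fi; case: ifP; rewrite ?(nabs0 Habs)// (nabs_nat Habs).
  - exists (coset x); split=> //; first exact: (open_mull HG).
    move=> y Uy; rewrite -(tgmulKVg HG x y) /fi /f.
    by rewrite cosetM.
have fE x : f x = 1 + \sum_(i <- S) fi i (inv i ** x).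
  rewrite {1}/f HF natrD; congr (_ + _).
  rewrite /push_flow natr_sum big_mkcond /=; apply: eq_bigr => i _.
  by rewrite /fi /f -act_coset; case: ifP.
have fE' x : f x = \sum_(i <- S) fi i x.
  have [|i iS sgi] := Hsg (coset x); first by move=> h; apply: ninf; exists x.
  rewrite (bigD1_seq i) ?undup_uniq//= /fi sgi eqxx big1 ?addr0//.
  by move=> j ji; case: eqP => // -[ij]; rewrite ij eqxx in ji.
have [[_ mD _ _ m1] _] := Hm.
have e1 : m f = \sum_(i <- S) m (fi i).
  by rewrite -mean_sum//; congr m; apply/funext.
have e2 : m f = 1 + \sum_(i <- S) m (fi i).
  rewrite -(mean_trans_sum S fi)// -m1 -mD; last 2 first.
  - by apply: Cb_cst; exact: (ssf1 HL).
  - by apply: (Cb_sum _ S (fun i x => fi i (inv i ** x))) => i; exact: Cb_trans.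
  by congr m; apply/funext.
move: e2; rewrite -e1 => /eqP; rewrite -subr_eq0 opprD addrCA subrr addr0.
by rewrite oppr_eq0 oner_eq0.
Qed.

End Invariant.

(* Translating by an element of [H] permutes the cosets of [V]. *)
Lemma transversal_sum_bound H V s g f eps : is_subgroup mul inv e H ->
  is_subgroup mul inv e V -> uniq s -> (forall x, x \in s -> H x) ->
  (forall u, H u -> exists2 x, x \in s & V (inv x ** u)) ->
  (forall x y, x \in s -> y \in s -> V (inv x ** y) -> x = y) ->
  0 <= eps -> (forall x v, H x -> V v -> abs (f (x ** v) - f x) <= eps) -> H g ->
  abs (\sum_(x <- s) f (inv g ** x) - \sum_(x <- s) f x) <= eps.
Proof.
move=> [He [HM Hi]] sV us sH cov sep eps0 fV Hg.
(* For [x] in [s], [h x] is the representative of the coset of [inv g x]; it permutes [s], which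
   allows a termwise comparison of the sums. *)
have /choice [h Hh] : forall x, exists y, x \in s ->
    y \in s /\ V (inv y ** (inv g ** x)).
  move=> x; have [xs|] := boolP (x \in s); last by exists x.
  have [|y ys Vy] := cov (inv g ** x); last by exists y.
  by apply: HM; [exact: Hi|exact: sH].
have hinj : {in s &, injective h}.
  move=> x y xs ys hxy; apply: sep => //.
  have [_ Vx] := Hh x xs; have [_ Vy] := Hh y ys; rewrite -hxy in Vy.
  have := subgrpT HG _ _ _ _ sV (subgrpVM HG _ _ _ sV Vx) Vy.
  by rewrite (tginvMg HG) -(tgmulgA HG) (tgmulKg HG (inv g)).
have hs : {subset map h s <= s} by move=> _ /mapP [x xs ->]; case: (Hh x xs).
have perm : perm_eq (map h s) s.
  have uh : uniq (map h s) by rewrite map_inj_in_uniq.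
  have [|_ /(uniq_perm uh us)//] := uniq_min_size uh hs.
  by rewrite size_map.
rewrite -[\sum_(x <- s) f x](perm_big _ perm) big_map -sumrB.
apply: (nabs_sum_le Habs) => // x xs.
have [hxs Vx] := Hh x xs; have := fV _ _ (sH _ hxs) Vx.
by rewrite (tgmulKVg HG).
Qed.

(** Compactness of [H] turns continuity at each point into uniformity under small right
    translations. *)
Lemma Cb_uniform H f eps : compact H -> CbL f -> 0 < eps ->
  \forall v \near e, H `<=` (fun x => abs (f (x ** v) - f x) < eps).
Proof.
move=> cH [_ [_ cf]] eps0; apply: (iffLR (compact_near_coveringP H) cH) => x Hx.
have [U [oU Ux Uf]] := cf x eps eps0.
have nU : nbhs x U by apply: open_nbhs_nbhs.
have : nbhs (x ** e) U by rewrite (tgmulg1 HG).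
move=> /(near_mul HG) [[A B] /= [nA nB] AB].
exists (U `&` A, B); first by split=> //; exact: filterI.
move=> [y v] /= [[Uy Ay] Bv]; rewrite -(subrKA (f x)).
apply: (le_lt_trans (abs_ultra Habs _ _)); rewrite gt_max.
rewrite (nabsB Habs (f x)) (Uf y Uy) andbT.
by apply: Uf; exact: (AB (y, v)).
Qed.

(** * Existence of invariant means by averaging *)

Section Existence.
Context (Htd : totally_disconnected [set: G]) (Hlc : locally_compact [set: G]).
Context (Hle : locally_elliptic mul inv e) (M : R) (M0 : 0 <= M).
Context (Hindex : forall U V k, osubgrp U -> osubgrp V -> V `<=` U ->
  index_is mul inv U V k -> 1 <= M * abs k%:R).

Definition coboundary (t : seq (G * (G -> K))) (x : G) : K :=
  \sum_(gf <- t) (gf.2 (inv gf.1 ** x) - gf.2 x).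

(** Choose [H] containing the translating elements and [V] so small that the functions vary by less
    than [eps] on its cosets in [H]. Summing over representatives of [H / V] leaves [k c] and kills
    the coboundary up to [eps]. *)
Lemma coboundary_bound c t eps : (forall gf, gf \in t -> CbL gf.2) -> 0 < eps ->
  CbL (fun x => c + coboundary t x) ->
  abs c <= M * Num.max (snorm (fun x => c + coboundary t x)) eps.
Proof.
move=> Ct eps0 CF; set F := (fun x => _).
have [H [oH cH tH]] := locally_elliptic_compact_open HG Htd Hlc
  (map fst t) Hle.
have [A nA HA] : exists2 A, nbhs e A & forall gf, gf \in t -> forall x v, H x ->
    A v -> abs (gf.2 (x ** v) - gf.2 x) < eps.
  elim: t Ct {CF F tH} => [|gf t IH] Ct; first by exists setT => //; exact: filterT.
  have [|A nA HA] := IH; first by move=> h ht; apply: Ct; rewrite inE ht orbT.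
  have nB := Cb_uniform H gf.2 eps cH (Ct _ (mem_head _ _)) eps0.
  exists (A `&` [set v | H `<=` (fun x => abs (gf.2 (x ** v) - gf.2 x) < eps)]).
    exact: filterI.
  move=> h; rewrite inE => /orP[/eqP->|ht] x v Hx [Av Bv]; first exact: Bv.
  exact: HA.
have [V [oV cV VA]] := van_dantzig HG Htd Hlc (A `&` H)
  (filterI nA (osubgrp_nbhs _ _ _ _ _ oH)).
have VH : V `<=` H by move=> x /VA [].
have [k ik] := finite_index HG H V oH.1 cH oV.
have kM := Hindex _ _ _ oH oV VH ik; case: ik => s [sk us sH cov sep].
have eqF : k%:R * c = \sum_(x <- s) F x - \sum_(gf <- t)
    (\sum_(x <- s) gf.2 (inv gf.1 ** x) - \sum_(x <- s) gf.2 x).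
  rewrite /F big_split /= /coboundary exchange_big /=.
  rewrite big_const_seq count_predT sk iter_addr_0 mulr_natl.
  rewrite [X in _ + X - _](eq_bigr _ (fun gf _ => sumrB _ _ _ _)).
  by rewrite addrK.
have kc : abs k%:R * abs c <= Num.max (snorm F) eps.
  rewrite -(nabsM Habs) eqF; apply: (nabsD_le Habs).
    apply: (nabs_sum_le Habs); first by rewrite le_max supnorm_ge0.
    by move=> x _; rewrite le_max supnorm_ge.
  rewrite (nabsN Habs); apply: (nabs_sum_le Habs).
    by rewrite le_max supnorm_ge0.
  move=> gf gft; rewrite le_max; apply/orP; right.
  apply: (transversal_sum_bound H V) => //; [exact: oH.1|exact: oV.1|exact: ltW| |].
    by move=> x v Hx /VA [Av _]; apply/ltW/HA.
  by apply: tH; exact: map_f.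
apply: (@le_trans _ _ (M * (abs k%:R * abs c))).
  rewrite mulrA -[leLHS]mul1r; apply: ler_wpM2r => //.
  exact: (nabs_ge0 Habs).
exact: ler_wpM2l.
Qed.

(** The maximum makes [eps] harmless: for a positive norm take [eps] equal to it, and for norm zero
    let [eps] tend to zero. *)
Lemma coboundary_bounded c t : (forall gf, gf \in t -> CbL gf.2) ->
  CbL (fun x => c + coboundary t x) ->
  abs c <= M * snorm (fun x => c + coboundary t x).
Proof.
move=> Ct CF; have N0 := supnorm_ge0 _ CF; set N := snorm _ in N0 *.
have bd eps := coboundary_bound c t eps Ct ^~ CF.
move: N0; rewrite le_eqVlt => /orP[/eqP N0|N0]; last first.
  by have := bd _ N0; rewrite -/N maxxx.
rewrite -N0 mulr0; apply/ler_addgt0Pl => eps eps0; rewrite addr0.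
have M1 : 0 < M + 1 by rewrite ltr_pwDr.
have d0 : 0 < eps / (M + 1) by exact: divr_gt0.
apply: (le_trans (bd _ d0)); rewrite -/N -N0 max_r ?(ltW d0)//.
by rewrite mulrA ler_pdivrMr// mulrC ler_pM2l// lerDl.
Qed.

Lemma Cb_coboundary c t : L c -> (forall gf, gf \in t -> CbL gf.2) ->
  CbL (fun x => c + coboundary t x).
Proof.
move=> Lc Ct; apply: CbD; first exact: Cb_cst.
elim: t Ct => [|gf t IH] Ct.
  rewrite [X in Cb _ _ X](_ : _ = fun=> 0).
    by apply: Cb_cst; exact: (ssf0 HL).
  by apply/funext => x; rewrite /coboundary big_nil.
have Cgf := Ct _ (mem_head _ _).
rewrite [X in Cb _ _ X](_ : _ = (fun x => -1 * gf.2 x + gf.2 (inv gf.1 ** x)) \+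
    coboundary t).
  apply: CbD; last by apply: IH => h ht; apply: Ct; rewrite inE ht orbT.
  apply: Cb_lin => //; last exact: Cb_trans.
  by apply: (ssfN HL); exact: (ssf1 HL).
apply/funext => x; rewrite /coboundary big_cons /= mulN1r; congr (_ + _); exact: addrC.
Qed.

(** The functional on constants plus coboundaries enters as a graph, and [coboundary_bounded] is
    both its norm bound and the reason why it is well defined. *)
Lemma invariant_mean_exists : exists m, invariant_mean abs L mul inv m /\
  forall f, CbL f -> abs (m f) <= M * snorm f.
Proof.
have L0 := ssf0 HL; have L1 := ssf1 HL.
pose V : lmodType K := (G -> K^o : Type).
pose Gam : set (V * K^o) := [set z | exists t : seq (G * (G -> K)),
  [/\ forall gf, gf \in t -> CbL gf.2, L z.2 &
      z.1 = (fun x => z.2 + coboundary t x)]].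
have [||||||m [mG mL mlin mM]] := ingleton R K abs Habs L HL V CbL snorm M M0 _ _ _ _ _ Gam.
- exact: Cb_cst.
- by move=> a u v; exact: Cb_lin.
- exact: supnorm_ge0.
- exact: supnormD.
- exact: supnormZ.
- split.
  + exists [::]; split=> //; apply/funext => x /=.
    by rewrite /coboundary big_nil addr0.
  + move=> a [f c] [g d] La [t [Ct Lc /= ->]] [u [Cu Ld /= ->]].
    exists ([seq (gf.1, fun x => a * gf.2 x) | gf <- t] ++ u); split=> /=.
    * move=> h; rewrite mem_cat => /orP[/mapP[gf gft ->]|/Cu//].
      by apply: CbZ => //; exact: Ct.
    * by apply: (ssfD HL) => //; apply: (ssfM HL).
    * apply/funext => x; rewrite /coboundary big_cat big_map /=.
      under eq_bigr do rewrite -mulrBr.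
      rewrite -mulr_sumr addrACA; congr (_ + _); exact: mulrDr.
  + move=> [f c] [t [Ct Lc /= ->]]; split=> //; exact: Cb_coboundary.
  + move=> [f c] [t [Ct Lc /= ->]]; apply: coboundary_bounded => //.
    exact: Cb_coboundary.
have m0 : m 0 = 0.
  have := mG (0, 0); apply; exists [::]; split=> //; apply/funext => x /=.
  by rewrite /coboundary big_nil addr0.
have C0 : CbL (fun=> 0) by exact: Cb_cst.
have mD f g : CbL f -> CbL g -> m (f \+ g) = m f + m g.
  by move=> Cf Cg; have := mlin 1 f g L1 Cf Cg; rewrite scale1r mul1r.
exists m; split=> //; split; first split=> //.
- move=> c f Lc Cf; have := mlin c f 0 Lc Cf C0.
  by rewrite m0 !addr0.
- by exists M.
- have := mG (fun=> 1, 1); apply; exists [::]; split=> //; apply/funext => x /=.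
  by rewrite /coboundary big_nil addr0.
(* Invariance holds because [g f - f] is a coboundary with constant term zero. *)
- move=> g f Cf; pose d : G -> K := fun x => f (inv g ** x) - f x.
  have dE : d = fun x => 0 + coboundary [:: (g, f)] x.
    by apply/funext => x; rewrite /coboundary big_seq1 add0r.
  have Ct gf : gf \in [:: (g, f)] -> CbL gf.2 by rewrite inE => /eqP->.
  have md : m d = 0 by have := mG (d, 0); apply; exists [:: (g, f)].
  have Cd : CbL d by rewrite dE; exact: Cb_coboundary.
  transitivity (m (d \+ f)); last by rewrite mD// md add0r.
  by congr m; apply/funext => x /=; rewrite subrK.
Qed.

End Existence.

(** [L] does not occur, so one set governs both [K] and [K0]. Its members turn out to be exactly the
    nonnegative constants that bound some invariant mean. *)
Definition mean_bounds : set R := [set M | 0 <= M /\ locally_elliptic mul inv e /\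
  forall U V k, osubgrp U -> osubgrp V -> V `<=` U ->
    index_is mul inv U V k -> 1 <= M * abs k%:R].

Context (Htd : totally_disconnected [set: G]) (Hlc : locally_compact [set: G]).

Lemma mean_boundsP m C : invariant_mean abs L mul inv m -> 0 <= C ->
  (forall f, CbL f -> abs (m f) <= C * snorm f) -> mean_bounds C.
Proof.
move=> Hm C0 mC; split=> //; split; first exact: mean_locally_elliptic Hm Htd Hlc.
exact: mean_index_bound Hm C mC.
Qed.

Lemma normed_amenableE : normed_amenable abs L mul inv <-> mean_bounds !=set0.
Proof.
split=> [[m Hm]|[M [M0 [le bd]]]].
  have [[_ _ _ [C mC] _] _] := Hm; exists `|C|.
  apply: mean_boundsP Hm _ _ => // f Cf; apply: (le_trans (mC f Cf)).
  by apply: ler_wpM2r; [exact: supnorm_ge0|exact: ler_norm].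
by have [m [Hm _]] := invariant_mean_exists Htd Hlc le M M0 bd; exists m.
Qed.

Lemma group_normE : group_norm abs L mul inv =
  ereal_inf [set M%:E | M in mean_bounds].
Proof.
apply/eqP; rewrite eq_le; apply/andP; split.
  apply: le_ereal_inf_tmp => _ [M [M0 [le bd]] <-].
  have [m [Hm mM]] := invariant_mean_exists Htd Hlc le M M0 bd.
  apply: (@le_trans _ _ (opnorm abs L m)).
    by apply: ge_ereal_inf; exists (opnorm abs L m) => //; exists m.
  by apply: ge_ereal_inf; exists M%:E => //; exists M.
apply: le_ereal_inf_tmp => _ [m Hm <-].
apply: le_ereal_inf_tmp => _ [C [C0 mC] <-].
by apply: ge_ereal_inf; exists C%:E => //; exists C => //; exact: mean_boundsP Hm C0 mC.
Qed.

End Means.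

(** * The closure of the prime field *)

Section PrimeField.
Context (R : realType) (K : fieldType) (abs : K -> R).
Context (Habs : is_nonarch_abs abs) (Hsc : spherically_complete abs).
Local Notation P := (@prime_subfield K).
Local Notation K0 := (K0set abs).

Lemma spherical_subfieldT : spherical_subfield R K abs setT.
Proof.
split=> // a r r0 _ H; have [|x Hx] := Hsc a r r0.
  move=> n y; rewrite /cball /= => yn; have [rn an] := H n n.+1 (leqnSn n).
  by apply: (nabsB_le Habs _ (a n.+1)) => //; exact: le_trans yn rn.
by exists x => // n; rewrite (nabsB Habs); exact: Hx.
Qed.

Lemma prime_subfield1 : P 1.
Proof. by exists 1, 1; rewrite divr1 oner_eq0. Qed.

Lemma prime_subfieldB x y : P x -> P y -> P (x - y).
Proof.
move=> [a [b [b0 ->]]] [c [d [d0 ->]]]; exists (a * d - c * b), (b * d).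
rewrite intrM mulf_neq0//; split=> //; rewrite intrB !intrM.
by rewrite -mulNr addf_div// mulNr.
Qed.

Lemma prime_subfieldM x y : P x -> P y -> P (x * y).
Proof.
move=> [a [b [b0 ->]]] [c [d [d0 ->]]]; exists (a * c), (b * d).
by rewrite !intrM mulf_neq0//; split=> //; rewrite mulf_div.
Qed.

Lemma prime_subfieldV x : P x -> P x^-1.
Proof.
move=> [a [b [b0 ->]]]; have [a0|a0] := eqVneq (a%:~R : K) 0.
  by rewrite a0 mul0r invr0; exists 0, 1; rewrite oner_eq0 mul0r.
by exists b, a; rewrite invf_div.
Qed.

Lemma prime_subfield_K0 x : P x -> K0 x.
Proof. by move=> Px eps eps0; exists x => //; rewrite subrr (nabs0 Habs). Qed.

Lemma nabsD_lt x y r : abs x < r -> abs y < r -> abs (x + y) < r.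
Proof.
by move=> xr yr; apply: (le_lt_trans (abs_ultra Habs _ _)); rewrite gt_max xr.
Qed.

(** The isosceles triangle principle. *)
Lemma nabs_near_eq x y : abs (x - y) < abs x -> abs y = abs x.
Proof.
move=> h; apply/eqP; rewrite eq_le; apply/andP; split.
  by rewrite -[y](subKr x); apply: (nabsD_le Habs) => //; rewrite (nabsN Habs) ltW.
rewrite leNgt; apply/negP => yx; have := nabsD_lt _ _ _ h yx.
by rewrite subrK ltxx.
Qed.

Lemma K0_closed x : (forall eps, 0 < eps -> exists2 y, K0 y & abs (x - y) < eps) ->
  K0 x.
Proof.
move=> H eps eps0; have [y Ky xy] := H _ eps0; have [z Pz yz] := Ky _ eps0.
by exists z => //; rewrite -(subrKA y); exact: nabsD_lt.
Qed.

Lemma K0B x y : K0 x -> K0 y -> K0 (x - y).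
Proof.
move=> Kx Ky eps eps0; have [p Pp xp] := Kx _ eps0; have [q Pq yq] := Ky _ eps0.
exists (p - q); first exact: prime_subfieldB.
rewrite [X in abs X](_ : _ = (x - p) - (y - q)); last by ring.
by apply: nabsD_lt => //; rewrite (nabsN Habs).
Qed.

Lemma nabsM_small a x eps : 0 < eps -> abs x < eps / (abs a + 1) ->
  abs (a * x) < eps.
Proof.
move=> eps0; have a1 : 0 < abs a + 1 by rewrite ltr_pwDr// (nabs_ge0 Habs).
rewrite ltr_pdivlMr// => h; apply: le_lt_trans h; rewrite (nabsM Habs) mulrC.
by apply: ler_wpM2l; [exact: (nabs_ge0 Habs)|rewrite lerDl].
Qed.

Lemma K0M x y : K0 x -> K0 y -> K0 (x * y).
Proof.
move=> Kx Ky eps eps0.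
have pos a : 0 < eps / (abs a + 1).
  by apply: divr_gt0 => //; rewrite ltr_pwDr// (nabs_ge0 Habs).
have [q Pq yq] := Ky _ (pos x); have [p Pp xp] := Kx _ (pos q).
exists (p * q); first exact: prime_subfieldM.
rewrite [X in abs X](_ : _ = x * (y - q) + q * (x - p)); last by ring.
by apply: nabsD_lt; exact: nabsM_small.
Qed.

Lemma K0_abs x : K0 x -> x != 0 -> exists2 y, P y & abs y = abs x.
Proof.
rewrite -(nabs_gt0 Habs) => Kx x0; have [y Py xy] := Kx _ x0.
by exists y => //; exact: nabs_near_eq.
Qed.

Lemma K0V x : K0 x -> K0 x^-1.
Proof.
move=> Kx; have [->|x0] := eqVneq x 0.
  by rewrite invr0 -(subrr 1); apply: K0B; exact/prime_subfield_K0/prime_subfield1.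
have ax : 0 < abs x by rewrite (nabs_gt0 Habs).
move=> eps eps0.
(* The first term gives [p] the absolute value of [x]; the second is then what brings
   [(p - x) / (x p)] below [eps]. *)
have [|p Pp xp] := Kx (Num.min (abs x) (eps * abs x ^+ 2)).
  by rewrite lt_min ax mulr_gt0// exprn_gt0.
move: xp; rewrite lt_min => /andP[h1 h2]; have px := nabs_near_eq _ _ h1.
have p0 : p != 0 by rewrite -(nabs_gt0 Habs) px.
exists p^-1; first exact: prime_subfieldV.
have -> : x^-1 - p^-1 = (p - x) / (x * p) by field; rewrite x0 p0.
rewrite (nabsM Habs) (nabsV Habs) (nabsM Habs) px (nabsB Habs) ltr_pdivrMr ?mulr_gt0//.
Qed.

(** As in Ostrowski's theorem, [q] is the value of the least positive integer [p] of value below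
    one: division with remainder shows that every positive integer of value below one is a multiple
    of [p]. *)
Lemma nabs_nat_powers : exists q : R, [/\ 0 <= q, q < 1 &
  forall n, (0 < n)%N -> exists v, abs n%:R = q ^+ v].
Proof.
have [ex|nex] := pselect (exists n, (0 < n)%N && (abs n%:R < 1)); last first.
  (* Here all values are one, and [q = 0] serves with exponent zero. *)
  exists 0; split=> // n n0; exists 0%N; rewrite expr0; apply/eqP.
  rewrite eq_le (nabs_nat Habs) leNgt; apply/negP => h; apply: nex; exists n.
  by rewrite n0.
case: (ex_minnP ex) => p /andP[p0 p1] pmin.
exists (abs p%:R); split=> //; first exact: (nabs_ge0 Habs).
have p_gt1 : (1 < p)%N.
  by rewrite ltn_neqAle p0 andbT; apply: contraTneq p1 => <-; rewrite (nabs1 Habs) ltxx.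
elim/ltn_ind=> n IH n0; have [n1|n1] := ltP (abs n%:R) 1; last first.
  by exists 0%N; apply/eqP; rewrite expr0 eq_le n1 (nabs_nat Habs).
have r0 : (n %% p)%N = 0%N.
  apply/eqP; rewrite -leqn0 leqNgt; apply/negP => r0.
  suff h : abs (n %% p)%N%:R < 1.
    by have := pmin (n %% p)%N; rewrite r0 h leqNgt ltn_pmod// => /(_ isT).
  have -> : (n %% p)%:R = n%:R - (n %/ p)%:R * p%:R :> K.
    by rewrite {2}(divn_eq n p) natrD natrM addrAC subrr add0r.
  apply: nabsD_lt => //; rewrite (nabsN Habs) (nabsM Habs).
  apply: le_lt_trans p1; rewrite -[leRHS]mul1r.
  by apply: ler_wpM2r; [exact: (nabs_ge0 Habs)|exact: (nabs_nat Habs)].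
have nE : n = (n %/ p * p)%N by rewrite {1}(divn_eq n p) r0 addn0.
have d0 : (0 < n %/ p)%N by move: n0; rewrite {1}nE muln_gt0 => /andP[].
have [v Hv] := IH _ (ltn_Pdiv p_gt1 n0) d0.
by exists v.+1; rewrite {1}nE natrM (nabsM Habs) Hv exprSr.
Qed.

Lemma nabs_int (a : int) : abs a%:~R = abs (`|a|%N)%:R.
Proof. by case: a => n //=; rewrite NegzE mulrNz (nabsN Habs). Qed.

(** Nonzero values of the prime field are quotients of powers of [q], so those above one are at
    least [q^-1]. If [q = 0] there are none above one, and [2] is an arbitrary choice. *)
Lemma prime_subfield_gap : exists2 c : R, 1 < c &
  forall x, P x -> 1 < abs x -> c <= abs x.
Proof.
have [q [q0 q1 Hq]] := nabs_nat_powers.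
have main x : P x -> 1 < abs x -> q != 0 /\ q^-1 <= abs x.
  move=> [a [b [b0 ->]]]; have bn0 : (0 < `|b|)%N.
    by rewrite absz_gt0; apply: contraNneq b0 => ->.
  rewrite (nabsM Habs) (nabsV Habs) !nabs_int.
  have ab : 0 < abs (`|b|%N)%:R by rewrite -nabs_int (nabs_gt0 Habs).
  have [w bw] := Hq _ bn0; rewrite ltr_pdivlMr// mul1r ler_pdivlMr// => ba.
  have an0 : (0 < `|a|)%N.
    by rewrite lt0n; apply: contraTneq (lt_trans ab ba) => ->; rewrite (nabs0 Habs) ltxx.
  have [v av] := Hq _ an0; rewrite bw av in ba ab *.
  have vw : (v < w)%N.
    rewrite ltnNge; apply/negP => wv; move: ba; rewrite ltNge.
    by rewrite ler_wiXn2l ?(ltW q1).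
  have qn0 : q != 0.
    by apply: contraTneq ab => ->; rewrite expr0n; case: w vw {bw ba} => // w _; rewrite ltxx.
  split=> //; rewrite ler_pdivrMl ?lt_def ?qn0// -exprS.
  by rewrite ler_wiXn2l ?(ltW q1).
have [qz|qz] := eqVneq q 0.
  by exists 2; [rewrite ltr1n|move=> x Px /(main _ Px) []; rewrite qz eqxx].
exists q^-1; last by move=> x Px /(main _ Px) [].
by rewrite invf_gt1// lt_def qz.
Qed.

(** If the radii tend to zero, a common point in [K] is a limit of the centres and lies in the
    closed set [K0]. Otherwise discreteness of the values yields a centre that already lies in all
    the balls. *)
Lemma spherical_subfield_K0 : spherical_subfield R K abs K0.
Proof.
have K01 : K0 1 by exact/prime_subfield_K0/prime_subfield1.
split=> //; [exact: K0B|exact: K0M|exact: K0V|].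
move=> a r r0 Ka H.
have [small|/existsNP [eps /not_implyP [eps0 /forallNP big]]] :=
    pselect (forall eps, 0 < eps -> exists n, r n < eps).
  have [x _ Hx] := ssf_inter spherical_subfieldT a r r0 (fun=> I) H.
  exists x => //; apply: K0_closed => eps /small [n rn]; exists (a n) => //.
  by rewrite (nabsB Habs); exact: le_lt_trans (Hx n) rn.
pose rho := inf (range r).
have hinf : has_inf (range r).
  split; first by exists (r 0%N), 0%N.
  by exists 0 => _ [n _ <-]; exact: ltW.
have rho_le n : rho <= r n by apply: ge_inf; [exact: hinf.2|exists n].
have rho0 : 0 < rho.
  apply: (lt_le_trans eps0); apply: lb_le_inf; first exact: hinf.1.
  by move=> _ [n _ <-]; rewrite leNgt; apply/negP/big.
have adh t : rho < t -> exists n, r n < t.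
  move=> ht; have [|_ [n _ <-] lt] := @inf_adherent R (range r) (t - rho) _ hinf.
    by rewrite subr_gt0.
  by exists n; move: lt; rewrite -/rho addrC subrK.
suff [N HN] : exists N, forall m, (N <= m)%N -> abs (a m - a N) <= rho.
  exists (a N) => // n; have [Nn|/ltnW nN] := leqP N n.
    exact: le_trans (HN n Nn) (rho_le n).
  by rewrite (nabsB Habs); case: (H n N nN).
(* The values of K0 are discrete, so they cannot accumulate at [rho] from above. *)
apply: contrapT => nN.
have far t : rho < t -> exists2 y, K0 y & rho < abs y < t.
  move=> /adh [N rN]; apply: contrapT => h; apply: nN; exists N => m Nm.
  rewrite leNgt; apply/negP => am; apply: h; exists (a m - a N); first exact: K0B.
  by rewrite am /=; apply: le_lt_trans rN; case: (H N m Nm).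
have [c c1 Hc] := prime_subfield_gap.
(* Two distinct values strictly between [rho] and [c * rho] have a ratio strictly between [1] and
   [c], which the gap forbids. *)
have [|y Ky /andP[y1 y2]] := far (c * rho); first by rewrite ltr_pMl.
have [z Kz /andP[z1 z2]] := far _ y1.
have z0 : 0 < abs z by exact: lt_trans z1.
have yz1 : 1 < abs (y / z) by rewrite (nabsM Habs) (nabsV Habs) ltr_pdivlMr ?mul1r.
have [|p Pp pyz] := K0_abs (y / z) (K0M _ _ Ky (K0V _ Kz)).
  by rewrite -(nabs_gt0 Habs); exact: lt_trans yz1.
have := Hc p Pp; rewrite pyz => /(_ yz1).
rewrite (nabsM Habs) (nabsV Habs) ler_pdivlMr// leNgt => /negP; apply.
by apply: (lt_trans y2); rewrite ltr_pM2l//; exact: lt_trans c1.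
Qed.

(** By Bezout, [1 = u k - v p] would have value below one if [k] did as well as [p]. *)
Lemma nabs_coprime p k : abs p%:R < 1 -> (0 < k)%N -> coprime k p ->
  abs k%:R = 1.
Proof.
move=> p1 k0 /(coprimeP _ k0) [[u v] /= uv].
apply/eqP; rewrite eq_le (nabs_nat Habs) leNgt; apply/negP => k1.
have small n m : abs m%:R < 1 -> abs (n%:R * m%:R) < 1.
  move=> m1; rewrite (nabsM Habs); apply: le_lt_trans m1; rewrite -[leRHS]mul1r.
  by apply: ler_wpM2r; [exact: (nabs_ge0 Habs)|exact: (nabs_nat Habs)].
have E : u%:R * k%:R - v%:R * p%:R = 1 :> K.
  have vu : (v * p <= u * k)%N by rewrite ltnW// -subn_gt0 uv.
  by rewrite -!natrM -natrB// uv.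
have : abs (1 : K) < 1 by rewrite -E; apply: nabsD_lt; rewrite ?(nabsN Habs); exact: small.
by rewrite (nabs1 Habs) ltxx.
Qed.

End PrimeField.

Arguments nabs_coprime {R K abs} _.

(** * Index bounds for [F_p], trivially valued [Q] and [Q_p] *)

Section MeanBounds.
Context (G : topologicalType) (mul : G -> G -> G) (inv : G -> G) (e : G).
Context (HG : is_topgroup mul inv e).
Context (R : realType) (K : fieldType) (abs : K -> R).
Context (Habs : is_nonarch_abs abs).
Local Notation bounds := (mean_bounds G mul inv e R K abs).
Local Notation lell := (locally_elliptic mul inv e).

Lemma index_gt0 U V k : is_subgroup mul inv e U -> index_is mul inv U V k ->
  (0 < k)%N.
Proof. by move=> [Ue _] [[|x s] [<- _ _ /(_ e Ue) [y]]]. Qed.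

Lemma mean_bounds_ge1 M : bounds M -> 1 <= M.
Proof.
move=> [_ [_ h]]; have oT := osubgrpT G mul inv e.
have : index_is mul inv setT setT 1.
  exists [:: e]; split=> //; first by move=> u _; exists e => //; exact: mem_head.
  by move=> x y; rewrite !inE => /eqP-> /eqP->.
by move=> /(h _ _ _ oT oT (fun _ _ => I)); rewrite (nabs1 Habs) mulr1.
Qed.

Lemma ereal_inf_mean_bounds M : bounds M -> (forall N, bounds N -> M <= N) ->
  ereal_inf [set N%:E | N in bounds] = M%:E.
Proof.
move=> bM Mmin; apply/eqP; rewrite eq_le; apply/andP; split.
  by apply: ge_ereal_inf; exists M%:E => //; exists M.
by apply: le_ereal_inf_tmp => _ [N bN <-]; rewrite lee_fin; exact: Mmin.
Qed.

(** No bound lies below one, and the infimum of the empty set is infinite; so the infimum is one as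
    soon as [1] is a bound, and never one without any bound. *)
Lemma mean_bounds_norm1 (Q : Prop) : (bounds !=set0 -> Q) -> (Q -> bounds 1) ->
  (bounds !=set0 <-> ereal_inf [set N%:E | N in bounds] = 1%E) /\
  (ereal_inf [set N%:E | N in bounds] = 1%E <-> Q).
Proof.
move=> bQ Qb.
have norm1 : Q -> ereal_inf [set N%:E | N in bounds] = 1%E.
  by move=> /Qb b1; apply: (ereal_inf_mean_bounds 1 b1) => N; exact: mean_bounds_ge1.
have ne : ereal_inf [set N%:E | N in bounds] = 1%E -> bounds !=set0.
  move=> h; apply/set0P/eqP => b0; move: h; rewrite b0 image_set0 ereal_inf0.
  by [].
by split; [split=> [/bQ/norm1|/ne]|split=> [/ne/bQ|/norm1]].
Qed.

(** An index divisible by [p] vanishes in [K], which no [M] can compensate; an index prime to [p]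
    has value one. *)
Lemma mean_bounds_modp p : prime p -> (p%:R : K) = 0 ->
  (bounds !=set0 -> lell /\ n_free mul inv e p) /\
  (lell /\ n_free mul inv e p -> bounds 1).
Proof.
move=> pp p0; split=> [[M [M0 [le h]]]|[le free]].
  split=> // U V oU oV VU k ik /dvdnP [d kE]; have := h _ _ _ oU oV VU ik.
  by rewrite kE natrM p0 mulr0 (nabs0 Habs) mulr0 ler10.
split=> //; split=> // U V k oU oV VU ik; rewrite mul1r.
rewrite (nabs_coprime Habs p)//.
- by rewrite p0 (nabs0 Habs).
- exact: index_gt0 oU.1 ik.
- by rewrite coprime_sym prime_coprime//; apply/negP/(free U V).
Qed.

Lemma mean_bounds_char0 : (forall n : nat, (0 < n)%N -> abs (n%:R : K) = 1) ->
  (bounds !=set0 -> lell) /\ (lell -> bounds 1).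
Proof.
move=> h; split=> [[M [M0 []]]//|le]; split=> //; split=> // U V k oU oV VU ik.
by rewrite h ?mulr1//; exact: index_gt0 oU.1 ik.
Qed.

Section Padic.
Context (p : nat) (pp : prime p) (absp : abs (p%:R : K) = (p%:R)^-1).

Let p_gt0 : 0 < p%:R :> R. Proof. by rewrite ltr0n prime_gt0. Qed.

Lemma padic_abs k : (0 < k)%N -> abs (k%:R : K) = (p%:R ^+ logn p k)^-1.
Proof.
move=> k0; have [m cop {1}->] := pfactor_coprime pp k0.
rewrite natrM natrX (nabsM Habs) (nabsX _ _ _ Habs) absp exprVn.
rewrite (nabs_coprime Habs p) ?mul1r// 1?coprime_sym//.
  by rewrite absp invf_lt1// ltr1n prime_gt1.
rewrite lt0n; apply: contraTneq cop => ->.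
by rewrite /coprime gcdn0 neq_ltn prime_gt1 ?orbT.
Qed.

Lemma padic_mean_bound M U V k j : bounds M ->
  open_subgroup mul inv e U -> open_subgroup mul inv e V -> V `<=` U ->
  index_is mul inv U V k -> (p ^ j %| k)%N -> p%:R ^+ j <= M.
Proof.
move=> [M0 [_ h]] oU oV VU ik pk; have k0 := index_gt0 _ _ _ oU.1 ik.
have := h _ _ _ oU oV VU ik; rewrite padic_abs// ler_pdivlMr ?exprn_gt0// mul1r.
by apply: le_trans; rewrite ler_weXn2l ?ler1n ?prime_gt0// -pfactor_dvdn.
Qed.

(** Freeness at exponent [j.+1] means that [p] divides each index at most [j] times, so the inverse
    of its value is at most [p ^ j]. *)
Lemma mean_bounds_padic j : lell -> n_free mul inv e (p ^ j.+1) ->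
  bounds (p ^ j)%:R.
Proof.
move=> le free; split=> //; split=> // U V k oU oV VU ik.
have k0 := index_gt0 _ _ _ oU.1 ik.
rewrite padic_abs// ler_pdivlMr ?exprn_gt0// mul1r natrX.
rewrite ler_weXn2l ?ler1n ?prime_gt0// -ltnS ltnNge -pfactor_dvdn//.
exact/negP/(free U V).
Qed.

Lemma mean_bounds_pN_free : bounds !=set0 <-> lell /\ pN_free mul inv e p.
Proof.
split=> [[M bM]|[le [[|j] [j0 free]]]] //; last first.
  by exists (p ^ j)%:R; exact: mean_bounds_padic.
(* The exponent [n] exceeds [M] and [p ^ n > n], so an index divisible by [p ^ n] would force a
   bound larger than [M]. *)
have [M0 [le _]] := bM; split=> //; exists (Num.truncn M).+1; split=> //.
move=> U V oU oV VU k ik pk; have := padic_mean_bound _ _ _ _ _ bM oU oV VU ik pk.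
rewrite leNgt => /negP; apply; apply: (lt_le_trans (truncnS_gt M)).
by rewrite -natrX ler_nat ltnW// ltn_expl// prime_gt1.
Qed.

(** For the least [k], a bound below [p ^ k] would make [G] already [p ^ k]-free, against
    minimality; for [k = 0] every bound is at least one. *)
Lemma padic_norm : bounds !=set0 -> exists k : nat,
  [/\ n_free mul inv e (p ^ k.+1),
      (forall j : nat, n_free mul inv e (p ^ j.+1) -> (k <= j)%N) &
      ereal_inf [set N%:E | N in bounds] = ((p ^ k)%:R : R)%:E].
Proof.
move=> /mean_bounds_pN_free [le [[|j0] [j0_gt0 free0]]] //.
have ex : exists j, `[< n_free mul inv e (p ^ j.+1) >] by exists j0; apply/asboolP.
case: (ex_minnP ex) => k /asboolP free kmin; exists k; split=> //.
  by move=> j fj; apply: kmin; apply/asboolP.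
apply: ereal_inf_mean_bounds; first exact: mean_bounds_padic.
move=> N bN; case: k free kmin => [|k] free kmin; first exact: mean_bounds_ge1.
rewrite natrX; apply: contrapT => Np.
suff /asboolP /kmin : n_free mul inv e (p ^ k.+1) by rewrite ltnn.
move=> U V oU oV VU i ii pi; apply: Np.
exact: padic_mean_bound bN oU oV VU ii pi.
Qed.

End Padic.
End MeanBounds.

Theorem theorem6p2
  (G : topologicalType) (mul : G -> G -> G) (inv : G -> G) (e : G)
  (HG : is_topgroup mul inv e)
  (Htd : totally_disconnected [set: G]) (Hlc : locally_compact [set: G])
  (R : realType) (K : fieldType) (abs : K -> R)
  (Habs : is_nonarch_abs abs) (Hsc : spherically_complete abs) :
  let K0 := K0set abs in
  let amenK := normed_amenable abs [set: K] mul inv in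
  let normK := group_norm abs [set: K] mul inv in
  [/\ (amenK <-> normed_amenable abs K0 mul inv),
      normK = group_norm abs K0 mul inv,
      (* 1. K0 = F_p *)
      (forall p : nat, prime p -> (p%:R : K) = 0 ->
         (amenK <-> normK = 1%E) /\
         (normK = 1%E <-> locally_elliptic mul inv e /\ n_free mul inv e p)),
      (* 2. K0 = Q (trivially valued) *)
      ((forall n : nat, (0 < n)%N -> abs (n%:R : K) = 1) ->
         (amenK <-> normK = 1%E) /\
         (normK = 1%E <-> locally_elliptic mul inv e)) &
      (* 3. K0 = Q_p, norm normalized by |p| = 1/p *)
      (forall p : nat, prime p -> abs (p%:R : K) = (p%:R)^-1 ->
         (amenK <-> locally_elliptic mul inv e /\ pN_free mul inv e p) /\
         (amenK -> exists k : nat,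
            [/\ n_free mul inv e (p ^ k.+1),
                (forall j : nat, n_free mul inv e (p ^ j.+1) -> (k <= j)%N) &
                normK = ((p ^ k)%:R : R)%:E]))].
Proof.
move=> K0 amenK normK.
have HK := spherical_subfieldT R K abs Habs Hsc.
have HK0 := spherical_subfield_K0 R K abs Habs Hsc.
have aE L (HL : spherical_subfield R K abs L) :=
  propext (normed_amenableE _ _ _ _ HG _ _ _ Habs _ HL Htd Hlc).
have nE L (HL : spherical_subfield R K abs L) :=
  group_normE _ _ _ _ HG _ _ _ Habs _ HL Htd Hlc.
(* Both fields are now described by the same set [mean_bounds], so their comparison becomes
   trivial. *)
rewrite /amenK /normK (aE _ HK) (aE _ HK0) (nE _ HK) (nE _ HK0).
split=> // [p pp p0|h|p pp absp].
- have [h1 h2] := mean_bounds_modp G mul inv e R K abs Habs p pp p0.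
  exact: (mean_bounds_norm1 G mul inv e R K abs Habs _ h1 h2).
- have [h1 h2] := mean_bounds_char0 G mul inv e R K abs h.
  exact: (mean_bounds_norm1 G mul inv e R K abs Habs _ h1 h2).
- split; first exact: (mean_bounds_pN_free _ _ _ _ _ _ _ Habs).
  exact: (padic_norm _ _ _ _ _ _ _ Habs).
Qed.
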